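(* Let $\mathbb{K}$ be a field, $r\in\mathbb{K}$ invertible and $q:=r-1$, and for each partition diagram $\pi$ let $\eta^{(q)}_\pi:=\sum_{\sigma\ge\pi}r^{l(\sigma)}M_\sigma\in\mathrm{ParQSym}$. Let $\rho=\rho_1\otimes\cdots\otimes\rho_n$ and $\sigma=\sigma_1\otimes\cdots\otimes\sigma_m$ be any non-empty partition diagrams, where $\rho_i,\sigma_j$ are non-empty $\otimes$-irreducible partition diagrams for $1\le i\le n$, $1\le j\le m$. Then $$\eta^{(q)}_\rho\star\eta^{(q)}_\sigma=\sum(-1)^{n_2(\pi')+n_3(\pi')}(-q)^{n_2(\pi')}\eta^{(q)}_{\pi'},$$ where the sum is over all expressions $\pi'=\pi_1\divideontimes_1\pi_2\divideontimes_2\cdots\divideontimes_{n+m-1}\pi_{n+m}$ such that $\pi_1\pi_2\cdots\pi_{n+m}$ is a word shuffle of $\rho_1\cdots\rho_n$ and $\sigma_1\cdots\sigma_m$, each $\divideontimes_l\in\{\otimes,\bullet\}$, and $\divideontimes_l$ can be $\bullet$ only when ($\pi_l=\rho_i$ and $\pi_{l+1}=\sigma_j$) or ($\pi_l=\sigma_j$ and $\pi_{l+1}=\rho_i$) for some $1\le i\le n$, $1\le j\le m$; and where $$n_2(\pi')=\#\{l:\ \pi_l=\rho_i,\ \pi_{l+1}=\sigma_j\text{ for some }1\le i\le n,\ 1\le j\le m\},$$ $$n_3(\pi')=\#\{l:\ \pi_l=\sigma_j,\ \pi_{l+1}=\rho_i\text{ for some }1\le i\le n,\ 1\le j\le m\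}.$$
   Context: Convention: $(-q)^0=1$ (also if $q=0$). **Shuffles.** In the sum the letters $\rho_1,\dots,\rho_n,\sigma_1,\dots,\sigma_m$ are treated as $n+m$ distinct letters (even if some coincide as diagrams), so there are $\binom{n+m}{n}$ word shuffles, and different pairs (shuffle, choice of $\divideontimes_1,\dots,\divideontimes_{n+m-1}$) are different expressions. **Partition diagrams.** A partition diagram of order $k\ge 0$ is a set partition of $\{1,\dots,k,1',\dots,k'\}$; for $k=0$ the only one is the empty diagram $\emptyset$. For $\pi$ of order $k$ and $\rho$ of order $m$, $\pi\otimes\rho$ is the diagram of order $k+m$ whose blocks are the blocks of $\pi$ and the blocks of $\rho$ with labels shifted by $k$ ($i\mapsto i+k$, $i'\mapsto (i+k)'$). If $k,m\ge1$, $\pi\bullet\rho$ is obtained from $\pi\otimes\rho$ by merging the block containing $k'$ with the block containing $(k+1)'$. The empty diagram is the unit for both operations. A diagram is $\otimes$-irreducible (resp. $\bullet$-irreducible) if it is not $\rho\otimes\sigma$ (resp. $\rho\bullet\sigma$) with $\rho,\sigma$ both non-empty. Every non-empty $\pi$ is uniquely $\pi_1\otimes\cdots\otimes\pi_l$ with all $\pi_i$ non-empty and $\otimes$-irreducible; $l(\pi):=l$, and $l(\emptyset):=0$. **Refinement.** Every non-empty $\pi$ can be uniquely written $\pi=\pi_1\divideontimes_1\pi_2\divideontimes_2\cdots\divideontimes_{n-1}\pi_n$ with each $\divideontimes_i\in\{\otimes,\bullet\}$ and each $\pi_i$ non-empty and both $\otimes$- and $\bullet$-irreducible (on non-empty diagrams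 $\otimes$ and $\bullet$ associate with each other, so no brackets are needed). Put $S(\pi)=\{i\in\{1,\dots,n-1\}:\divideontimes_i=\otimes\}$. For non-empty $\pi,\sigma$ write $\pi\sim\sigma$ if their sequences $(\pi_1,\dots,\pi_n)$ and $(\sigma_1,\dots,\sigma_m)$ are equal; $\pi\le\sigma$ if $\pi\sim\sigma$ and $S(\sigma)\subseteq S(\pi)$. The empty diagram is related only to itself, with $\emptyset\le\emptyset$. **Algebra ParQSym.** $\mathrm{ParQSym}$ is the $\mathbb{K}$-vector space with basis $\{M_\pi\}$ indexed by all partition diagrams, with product $\star$: $M_\emptyset$ is the unit, and for non-empty $\rho=\rho_1\otimes\cdots\otimes\rho_n$, $\sigma=\sigma_1\otimes\cdots\otimes\sigma_m$ with all $\rho_i,\sigma_j$ non-empty $\otimes$-irreducible, $$M_\rho\star M_\sigma=\sum M_{(\rho'_1\bullet\sigma'_1)\otimes\cdots\otimes(\rho'_k\bullet\sigma'_k)},$$ over all $k\in\mathbb{N}$ and all pairs of sequences of diagrams $(\rho'_1,\dots,\rho'_k)$, $(\sigma'_1,\dots,\sigma'_k)$ that become $(\rho_1,\dots,\rho_n)$, respectively $(\sigma_1,\dots,\sigma_m)$, after deleting all empty diagrams, and such that $\rho'_s\bullet\sigma'_s\ne\emptyset$ for all $1\le s\le k$.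
   Formalization: n_2 and n_3 count only those l whose juncture ⋇_l is •; counting all adjacencies as printed makes the formula false (e.g. n=m=1, ρ≠σ, r=1, q=0, where M_{ρ⊗σ} would get coefficient 0 instead of 1). *)

(* Defs.v *)
From HB Require Import structures.
From mathcomp Require Import all_boot all_order all_algebra.
From mathcomp Require Import finmap.
From mathcomp Require Import boolp classical_sets cardinality fsbigop.
From mathcomp Require Import monalg.
(* Imported last: cover, trivIset, partition and the set operations below are
   those of finset, not their homonyms on classical sets. *)
From mathcomp Require Import finset.

Set Implicit Arguments.
Unset Strict Implicit.
Unset Printing Implicit Defensive.

Import GRing.Theory.
Local Open Scope set_scope.
Local Open Scope ring_scope.

(* The vertices 1, ..., k are inl 0, ..., inl k.-1 and the vertices 1', ..., k'
   are inr 0, ..., inr k.-1. *)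
Definition vertex (k : nat) : finType := ('I_k + 'I_k)%type.

Definition pdiag_of (k : nat) :=
  {P : {set {set vertex k}} | partition P [set: vertex k]}.

Definition pdiag := {k : nat & pdiag_of k}.

Fact partition_set0 : partition (set0 : {set {set vertex 0}}) [set: vertex 0].
Proof.
apply/and3P; split; last by rewrite inE.
- by rewrite /cover big_set0; apply/eqP/setP => -[[]|[]].
- by apply/trivIsetP => A B; rewrite inE.
Qed.

Definition pempty : pdiag := Tagged pdiag_of (exist _ set0 partition_set0).

Section Tensor.
Variables k m : nat.

Definition shl (x : vertex k) : vertex (k + m) :=
  match x with inl i => inl (lshift m i) | inr i => inr (lshift m i) end.
Definition shr (x : vertex m) : vertex (k + m) :=
  match x with inl i => inl (rshift k i) | inr i => inr (rshift k i) end.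

Definition tensor_blocks (P : {set {set vertex k}}) (Q : {set {set vertex m}}) :
    {set {set vertex (k + m)}} :=
  [set shl @: B | B : {set vertex k} in P]
    :|: [set shr @: B | B : {set vertex m} in Q].

Lemma shl_inj : injective shl.
Proof. by move=> [i|i] [j|j] //= [] /val_inj ->. Qed.

Lemma shr_inj : injective shr.
Proof.
by move=> [i|i] [j|j] //= [] /addnI/val_inj ->.
Qed.

Lemma shlr_neq x y : shl x != shr y.
Proof.
by case: x => i; case: y => j //=; apply/eqP => -[] e;
  have := ltn_ord i; rewrite e ltnNge leq_addr.
Qed.

Lemma vertexP (z : vertex (k + m)) : (exists x, z = shl x) \/ (exists x, z = shr x).
Proof.
by case: z => z; case: (split_ordP z) => j ->;
  [left; exists (inl j)|right; exists (inl j)|left; exists (inr j)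
  |right; exists (inr j)].
Qed.

Lemma tensor_partition P Q : partition P [set: vertex k] ->
  partition Q [set: vertex m] ->
  partition (tensor_blocks P Q) [set: vertex (k + m)].
Proof.
move=> /and3P[/eqP cP tP nP] /and3P[/eqP cQ tQ nQ]; apply/and3P; split.
- apply/eqP/setP => z; rewrite [RHS]inE; apply/bigcupP.
  case: (vertexP z) => -[x ->].
    have : x \in cover P by rewrite cP inE.
    move=> /bigcupP[B BP xB]; exists (shl @: B); last exact: imset_f.
    by rewrite inE imset_f.
  have : x \in cover Q by rewrite cQ inE.
  move=> /bigcupP[B BP xB]; exists (shr @: B); last exact: imset_f.
  by rewrite inE orbC imset_f.
- apply/trivIsetP => A B; rewrite !inE.
  move=> /orP[]/imsetP[A' A'P ->] /orP[]/imsetP[B' B'P ->] AB.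
  + rewrite -setI_eq0 -imsetI; last by move=> ? ? _ _; exact: shl_inj.
    have /eqP -> : A' :&: B' == set0.
      rewrite setI_eq0; apply: (trivIsetP tP) => //.
      by apply: contraNneq AB => ->.
    by rewrite imset0.
  + rewrite -setI_eq0; apply/eqP/setP => z; rewrite !inE.
    apply/negP => /andP[/imsetP[x _ ->] /imsetP[y _ /eqP]].
    by rewrite (negPf (shlr_neq _ _)).
  + rewrite -setI_eq0; apply/eqP/setP => z; rewrite !inE.
    apply/negP => /andP[/imsetP[x _ ->] /imsetP[y _ /esym/eqP]].
    by rewrite (negPf (shlr_neq _ _)).
  + rewrite -setI_eq0 -imsetI; last by move=> ? ? _ _; exact: shr_inj.
    have /eqP -> : A' :&: B' == set0.
      rewrite setI_eq0; apply: (trivIsetP tQ) => //.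
      by apply: contraNneq AB => ->.
    by rewrite imset0.
- rewrite inE negb_or; apply/andP; split; apply/negP => /imsetP[B BP /esym/eqP].
    by rewrite imset_eq0 => /eqP B0; move: nP; rewrite -B0 BP.
  by rewrite imset_eq0 => /eqP B0; move: nQ; rewrite -B0 BP.
Qed.

End Tensor.

Section Merge.
Variable T : finType.

Definition merge_blocks (P : {set {set T}}) (x y : T) : {set {set T}} :=
  (pblock P x :|: pblock P y) |: (P :\: [set pblock P x; pblock P y]).

Lemma merge_partition P x y : partition P [set: T] ->
  partition (merge_blocks P x y) [set: T].
Proof.
move=> /and3P[/eqP cP tP nP].
have pP z : pblock P z \in P by rewrite pblock_mem // cP inE.
have pz z : z \in pblock P z by rewrite mem_pblock cP inE.
have dj z B : B \in P -> B != pblock P z -> [disjoint B & pblock P z].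
  by move=> BP; apply: (trivIsetP tP).
apply/and3P; split.
- apply/eqP/setP => z; rewrite [RHS]inE; apply/bigcupP.
  have [zxy|zxy] := boolP (pblock P z \in [set pblock P x; pblock P y]).
    exists (pblock P x :|: pblock P y); first by rewrite setU11.
    move: zxy; rewrite !inE => /orP[]/eqP <-; rewrite pz ?orbT //.
  by exists (pblock P z) => //; rewrite in_setU1 in_setD zxy pP orbT.
- have dU B : B \in P :\: [set pblock P x; pblock P y] ->
      [disjoint B & pblock P x :|: pblock P y].
    rewrite !inE negb_or => /andP[/andP[Bx By] BP].
    by rewrite -setI_eq0 setIUr setU_eq0 !setI_eq0 !dj.
  apply/trivIsetP => A B /setU1P[->|A1] /setU1P[->|B1] AB.
  + by rewrite eqxx in AB.
  + by rewrite disjoint_sym dU.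
  + exact: dU.
  + by apply: (trivIsetP tP) => //; [case/setDP: A1|case/setDP: B1].
- apply/negP => /setU1P[/esym/setP/(_ x)|/setDP[]]; last by rewrite (negPf nP).
  by rewrite !inE pz.
Qed.

End Merge.

Definition tensor_of k m (P : pdiag_of k) (Q : pdiag_of m) : pdiag_of (k + m) :=
  exist _ (tensor_blocks (val P) (val Q)) (tensor_partition (valP P) (valP Q)).

Definition tensor (p q : pdiag) : pdiag :=
  Tagged pdiag_of (tensor_of (tagged p) (tagged q)).

(* For orders k.+1 and m.+1 the merged blocks are those of (k.+1)' and (k.+2)'. *)
Definition bullet_of k m (P : pdiag_of k.+1) (Q : pdiag_of m.+1) :
    pdiag_of (k.+1 + m.+1) :=
  exist _ (merge_blocks (val (tensor_of P Q))
             (inr (lshift m.+1 ord_max)) (inr (rshift k.+1 ord0)))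
          (merge_partition _ _ (valP (tensor_of P Q))).

Definition bullet (p q : pdiag) : pdiag :=
  match p, q with
  | existT 0 _, _ => q
  | _, existT 0 _ => p
  | existT k.+1 P, existT m.+1 Q => Tagged pdiag_of (bullet_of P Q)
  end.

Definition irreducible (op : pdiag -> pdiag -> pdiag) (p : pdiag) : Prop :=
  ~ exists r s, [/\ r != pempty, s != pempty & p = op r s].

Definition tensors (s : seq pdiag) : pdiag := foldr tensor pempty s.

Definition tensor_factorization (p : pdiag) (s : seq pdiag) : Prop :=
  (forall x, x \in s -> x != pempty /\ irreducible tensor x) /\ p = tensors s.

(* The sequence of factors exists and is unique, so the choice made by xget is
   the only one possible. *)
Definition tensor_factors (p : pdiag) : seq pdiag :=
  xget [::] [set s | tensor_factorization p s]%classic.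

Definition plength (p : pdiag) : nat := size (tensor_factors p).

Variant juncture := Tensor | Bullet.

Definition bool_of_juncture (o : juncture) : bool := if o is Bullet then true else false.
Definition juncture_of_bool (b : bool) : juncture := if b then Bullet else Tensor.
Lemma bool_of_junctureK : cancel bool_of_juncture juncture_of_bool.
Proof. by case. Qed.
HB.instance Definition _ := Finite.copy juncture (can_type bool_of_junctureK).

Definition join_by (o : juncture) : pdiag -> pdiag -> pdiag :=
  match o with Tensor => tensor | Bullet => bullet end.

(* expression [:: p1; ..; pn] [:: o1; ..; o(n-1)] is the value of
   p1 o1 p2 o2 .. o(n-1) pn; it is only meaningful when there is one juncture
   fewer than there are diagrams. *)
Fixpoint expression (s : seq pdiag) (o : seq juncture) : pdiag :=
  match s, o with
  | [::], _ => pempty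
  | p :: _, [::] => p
  | p :: s', o1 :: o' => join_by o1 p (expression s' o')
  end.

Definition full_factorization (p : pdiag) (s : seq pdiag) (o : seq juncture) : Prop :=
  [/\ size s = (size o).+1,
      forall x, x \in s ->
        [/\ x != pempty, irreducible tensor x & irreducible bullet x]
    & p = expression s o].

Definition tensor_positions (o : seq juncture) : set nat :=
  [set i | nth Bullet o i = Tensor]%classic.

(* A full factorization of a non-empty diagram exists and is unique. *)
Definition pdiag_le (p q : pdiag) : Prop :=
  (p = pempty /\ q = pempty) \/
  exists s o o', [/\ full_factorization p s o, full_factorization q s o' &
    (tensor_positions o' `<=` tensor_positions o)%classic].

Notation ParQSym K := {malg K[pdiag]}.

Section Algebra.
Variable K : fieldType.

Definition Mbasis (p : pdiag) : ParQSym K := << p >>.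

(* The pairs of sequences obtained from a and b by inserting empty diagrams,
   of the same length and without a position where both are empty. *)
Definition stuffles (a b : seq pdiag) : set (seq pdiag * seq pdiag) :=
  [set c | [/\ size c.1 = size c.2,
               filter (predC1 pempty) c.1 = a,
               filter (predC1 pempty) c.2 = b
             & all (fun xy => bullet xy.1 xy.2 != pempty) (zip c.1 c.2)]]%classic.

(* Sums over (i \in A) range over a set A that is in fact finite, although only
   the finiteness of the support is built into the operator. *)
Definition star_basis (p q : pdiag) : ParQSym K :=
  if p == pempty then Mbasis q else
  if q == pempty then Mbasis p else
  \sum_(c \in stuffles (tensor_factors p) (tensor_factors q))
    Mbasis (tensors [seq bullet xy.1 xy.2 | xy <- zip c.1 c.2]).

Definition star (u v : ParQSym K) : ParQSym K :=
  \sum_(p <- msupp u) \sum_(q <- msupp v) (u@_p * v@_q) *: star_basis p q.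

(* eta r is the family of the eta^(q) with q = r - 1. *)
Definition eta (r : K) (p : pdiag) : ParQSym K :=
  \sum_(s \in [set s | pdiag_le p s]%classic) r ^+ plength s *: Mbasis s.

End Algebra.

(* A word in the n + m distinct letters rho_i (inl i) and sigma_j (inr j). *)
Definition word (n m : nat) := (n + m).-tuple ('I_n + 'I_m)%type.

Section Shuffle.
Variables n m : nat.

Definition is_shuffle (w : word n m) : bool :=
  (pmap (fun x : 'I_n + 'I_m => if x is inl i then Some i else None) w == enum 'I_n) &&
  (pmap (fun x : 'I_n + 'I_m => if x is inr j then Some j else None) w == enum 'I_m).

Definition rho_at (w : word n m) (l : nat) : bool :=
  if onth w l is Some (inl _) then true else false.
Definition sigma_at (w : word n m) (l : nat) : bool :=
  if onth w l is Some (inr _) then true else false.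

(* The juncture l stands between the letters l and l.+1 (counted from 0). *)
Definition admissible (w : word n m) (o : (n + m).-1.-tuple juncture) : bool :=
  [forall l : 'I_(n + m).-1, (tnth o l == Bullet) ==>
    (rho_at w l && sigma_at w l.+1) || (sigma_at w l && rho_at w l.+1)].

(* n2 and n3 count bullets only, at positions rho_i . sigma_j resp. sigma_j . rho_i:
   a Tensor between such letters contributes no factor. For n = m = 1 the
   product formula reads
     eta_rho * eta_sigma = eta_(rho (x) sigma) + eta_(sigma (x) rho)
       + q eta_(rho o sigma) - eta_(sigma o rho)
   with o the bullet, so that the tensor terms do have coefficient 1. *)
Definition n2 (w : word n m) (o : (n + m).-1.-tuple juncture) : nat :=
  #|[set l : 'I_(n + m).-1 |
      [&& tnth o l == Bullet, rho_at w l & sigma_at w l.+1]]|.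
Definition n3 (w : word n m) (o : (n + m).-1.-tuple juncture) : nat :=
  #|[set l : 'I_(n + m).-1 |
      [&& tnth o l == Bullet, sigma_at w l & rho_at w l.+1]]|.

Definition letters (rho : 'I_n -> pdiag) (sigma : 'I_m -> pdiag) (w : word n m) :
    seq pdiag :=
  [seq (match x with inl i => rho i | inr j => sigma j end) | x <- w].

End Shuffle.

(* Main.v *)
Require Import Defs.
From mathcomp Require Import all_boot all_order all_algebra.
From mathcomp Require Import zify.
From mathcomp Require Import finmap.
From mathcomp Require Import boolp classical_sets functions cardinality fsbigop.
From mathcomp Require Import monalg.
From mathcomp Require Import finset.

(** Evaluate everything against an arbitrary function [f] of diagrams with values
    in a vector space, the theorem being the case [f p = M_p]. Both sides are
    then computed letter by letter from the left. For an [⊗]-irreducible [x],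
      [eta (x ⊗ p) f = r eta p (f ∘ (x ⊗ _)) + eta p (f ∘ (x • _))],
      [eta (x • p) f = eta p (f ∘ (x • _))].
    Hence the sum over the admissible junctures of a word [x y w] satisfies
    [X(x y w) f = r X(y w) (f ∘ (x ⊗ _)) + (1 + c) X(y w) (f ∘ (x • _))], where
    [1 + c] is [1 + q = r] if [x] is a [rho] and [y] a [sigma], is [1 - 1 = 0] in
    the opposite case, and [1] otherwise. On the other side a product of two etas
    is a sum over coarsenings of both factorizations, whose blocks are stuffled;
    sorted by the first pair [(c, ∅)], [(∅, d)] or [(c, d)] of the stuffle, these
    sums obey the same recursion: in [c • d] all the [rho]s come before the [sigma]s,
    and the weight [r^2] of the two blocks is one factor [r] more than that of a
    single [⊗]-factor. *)

Set Implicit Arguments.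
Unset Strict Implicit.
Unset Printing Implicit Defensive.

(** * Diagrams as relations, and Levi's lemma *)

Local Notation order := (@tag nat pdiag_of).

Definition vcode k (x : vertex k) : bool * nat :=
  match x with inl i => (false, i : nat) | inr i => (true, i : nat) end.

Definition vshift k (x : bool * nat) : bool * nat := (x.1, k + x.2).

(* The blocks of diagrams of all orders are compared through the relation
   "in the same block" on the pairs (false, i) for i+1 and (true, i) for (i+1)'. *)
Definition linked (p : pdiag) (x y : bool * nat) : bool :=
  [exists u : vertex (order p), exists v : vertex (order p),
    [&& vcode u == x, vcode v == y & v \in pblock (val (tagged p)) u]].

Lemma vcode_inj k : injective (@vcode k).
Proof. by move=> [i|i] [j|j] //= [] /val_inj ->. Qed.

Lemma vcode_lt k (u : vertex k) : (vcode u).2 < k.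
Proof. by case: u => i /=. Qed.

Lemma vcodeP k (x : bool * nat) : x.2 < k -> exists u : vertex k, x = vcode u.
Proof.
case: x => -[] i /= lt_ik; first by exists (inr (Ordinal lt_ik)).
by exists (inl (Ordinal lt_ik)).
Qed.

Lemma vcode_shl k m (u : vertex k) : vcode (shl m u) = vcode u.
Proof. by case: u. Qed.

Lemma vcode_shr k m (u : vertex m) : vcode (shr k u) = vshift k (vcode u).
Proof. by case: u. Qed.

Lemma linkedE p (u v : vertex (order p)) :
  linked p (vcode u) (vcode v) = (v \in pblock (val (tagged p)) u).
Proof.
apply/existsP/idP => [[u' /existsP[v' /and3P[/eqP/vcode_inj-> /eqP/vcode_inj->]]]|uv] //.
by exists u; apply/existsP; exists v; rewrite !eqxx.
Qed.

Lemma linked_lt p x y : linked p x y -> (x.2 < order p) && (y.2 < order p).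
Proof. by case/existsP=> u /existsP[v /and3P[/eqP<- /eqP<- _]]; rewrite !vcode_lt. Qed.

Lemma pdiag_trivIset k (P : pdiag_of k) : trivIset (val P).
Proof. by case/and3P: (valP P). Qed.

Lemma pdiag_cover k (P : pdiag_of k) u : u \in cover (val P).
Proof. by case/and3P: (valP P) => /eqP -> _ _; rewrite inE. Qed.

Lemma mem_pdiag_pblock k (P : pdiag_of k) u : u \in pblock (val P) u.
Proof. by rewrite mem_pblock pdiag_cover. Qed.

Lemma pdiag_pblock_mem k (P : pdiag_of k) u : pblock (val P) u \in val P.
Proof. by rewrite pblock_mem // pdiag_cover. Qed.

Lemma linked_refl p x : linked p x x = (x.2 < order p).
Proof.
apply/idP/idP => [/linked_lt/andP[]//|/vcodeP[u ->]].
by rewrite linkedE mem_pdiag_pblock.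
Qed.

Lemma linked_sym p x y : linked p x y = linked p y x.
Proof.
suff imp a b : linked p a b -> linked p b a by apply/idP/idP; apply: imp.
move: a b => {}x {}y xy; have /andP[/vcodeP[u xE] /vcodeP[v yE]] := linked_lt xy.
move: xy; rewrite xE yE !linkedE -!eq_pblock ?pdiag_trivIset ?pdiag_cover //.
by rewrite eq_sym.
Qed.

(** Blocks are non-empty, so each is the [pblock] of one of its vertices and the relation determines
    the partition. Equalities of diagrams thus become comparisons of links. *)
Lemma pdiag_ext p q : order p = order q ->
  (forall x y, x.2 < order p -> y.2 < order p -> linked p x y = linked q x y) -> p = q.
Proof.
case: p q => k P [j Q] /= kj; rewrite -{}kj in Q * => PQ.
congr (Tagged pdiag_of _).
have eqb u : pblock (val P) u = pblock (val Q) u.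
  apply/setP => v; rewrite -(@linkedE (existT _ k P)) -(@linkedE (existT _ k Q)).
  exact/PQ/vcode_lt/vcode_lt.
have sub (A B : pdiag_of k) : pblock (val A) =1 pblock (val B) -> val A \subset val B.
  move=> AB; apply/fintype.subsetP => C CA.
  have [u uC] : exists u, u \in C.
    apply/set0Pn; apply: contraTneq CA => ->.
    by case/and3P: (valP A).
  rewrite -(def_pblock (pdiag_trivIset A) CA uC) AB; exact: pdiag_pblock_mem.
apply/val_inj/eqP; rewrite eqEsubset !sub // => u; exact/esym/eqb.
Qed.

Lemma order0_pempty p : order p = 0 -> p = pempty.
Proof. by move=> p0; apply: pdiag_ext => // x y; rewrite p0. Qed.

Lemma pempty_order p : (p == pempty) = (order p == 0).
Proof. by apply/eqP/eqP => [->|/order0_pempty]. Qed.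

Lemma order_gt0 p : p != pempty -> 0 < order p.
Proof. by rewrite pempty_order lt0n. Qed.

(** Restriction to an interval of columns is what cuts the middle factor out of a diagram in Levi's
    lemma. *)
Lemma window_exists p i j : i + j <= order p ->
  exists t, order t = j /\ forall x y, x.2 < j -> y.2 < j ->
    linked t x y = linked p (vshift i x) (vshift i y).
Proof.
move=> le_ij.
have lt_ij (a : 'I_j) : i + a < order p.
  by rewrite (leq_trans _ le_ij) // ltn_add2l.
pose f (u : vertex j) : vertex (order p) := match u with
  inl a => inl (Ordinal (lt_ij a)) | inr a => inr (Ordinal (lt_ij a)) end.
have fE u : vcode (f u) = vshift i (vcode u) by case: u.
pose g u := pblock (val (tagged p)) (f u).
pose t : pdiag := Tagged pdiag_of
  (exist (fun P => partition P setT) _ (preim_partitionP g setT)).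
exists t; split=> // x y /vcodeP[u ->] /vcodeP[v ->].
rewrite -!fE linkedE (@linkedE t) pblock_equivalence_partition ?inE //.
  by rewrite /= /g eq_pblock ?pdiag_trivIset ?pdiag_cover.
by split=> // /eqP->.
Qed.

Lemma vshiftP k (x : bool * nat) : x.2 < k \/ exists y, x = vshift k y.
Proof.
case: (ltnP x.2 k) => [|le]; [by left|right].
by exists (x.1, x.2 - k); rewrite /vshift /= subnKC // -surjective_pairing.
Qed.

(** * Links in tensor and bullet products *)

Lemma order_tensor p q : order (tensor p q) = order p + order q.
Proof. by []. Qed.

Lemma tensor_pblock_l k m (P : pdiag_of k) (Q : pdiag_of m) u :
  pblock (tensor_blocks (val P) (val Q)) (shl m u) = @shl k m @: pblock (val P) u.
Proof.
apply: def_pblock; first exact: (pdiag_trivIset (tensor_of P Q)).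
  by rewrite inE imset_f ?pdiag_pblock_mem.
by rewrite imset_f ?mem_pdiag_pblock.
Qed.

Lemma tensor_pblock_r k m (P : pdiag_of k) (Q : pdiag_of m) u :
  pblock (tensor_blocks (val P) (val Q)) (shr k u) = @shr k m @: pblock (val Q) u.
Proof.
apply: def_pblock; first exact: (pdiag_trivIset (tensor_of P Q)).
  by rewrite inE orbC imset_f ?pdiag_pblock_mem.
by rewrite imset_f ?mem_pdiag_pblock.
Qed.

Lemma linked_tensor_ll p q x y : x.2 < order p -> y.2 < order p ->
  linked (tensor p q) x y = linked p x y.
Proof.
move=> /vcodeP[u ->] /vcodeP[v ->].
rewrite -{1}(vcode_shl (order q) u) -{1}(vcode_shl (order q) v) (@linkedE (tensor p q)).
by rewrite linkedE /= tensor_pblock_l mem_imset //; apply: shl_inj.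
Qed.

Lemma linked_tensor_rr p q x y :
  linked (tensor p q) (vshift (order p) x) (vshift (order p) y) = linked q x y.
Proof.
have [xl|xl] := ltnP x.2 (order q); last first.
  by apply/idP/idP => /linked_lt /=; rewrite ?ltn_add2l ltnNge xl.
have [yl|yl] := ltnP y.2 (order q); last first.
  by apply/idP/idP => /linked_lt /=; rewrite ?ltn_add2l andbC ltnNge yl.
case/vcodeP: xl => u ->; case/vcodeP: yl => v ->.
rewrite -!vcode_shr (@linkedE (tensor p q)).
by rewrite linkedE /= tensor_pblock_r mem_imset //; apply: shr_inj.
Qed.

Lemma linked_tensor_lr p q x y : x.2 < order p ->
  linked (tensor p q) x (vshift (order p) y) = false.
Proof.
move=> /vcodeP[u ->]; case l: (linked _ _ _) => //; have /= := linked_lt l.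
rewrite ltn_add2l andbC => /andP[/vcodeP[v vE] _]; move: l.
rewrite vE -vcode_shr -{1}(vcode_shl (order q) u) (@linkedE (tensor p q)).
rewrite /= tensor_pblock_l => /imsetP[w _ /eqP]; by rewrite eq_sym (negPf (shlr_neq _ _)).
Qed.

(** Vertices are linked after merging either inside an old block or by crossing between the blocks
    of [a] and [b], which may coincide. *)
Lemma merge_pblock (T : finType) (P : {set {set T}}) a b u v :
  partition P [set: T] ->
  (v \in pblock (merge_blocks P a b) u) =
  [|| v \in pblock P u, (u \in pblock P a) && (v \in pblock P b)
    | (u \in pblock P b) && (v \in pblock P a)].
Proof.
move=> Pp; have [_ mT _] := and3P (merge_partition a b Pp).
have [/eqP cP tP _] := and3P Pp.
have pP z : pblock P z \in P by rewrite pblock_mem // cP inE.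
have pz z : z \in pblock P z by rewrite mem_pblock cP inE.
have pE y z : y \in pblock P z -> pblock P y = pblock P z by apply: same_pblock.
have memC y z : (y \in pblock P z) = (z \in pblock P y).
  by rewrite -!eq_pblock ?cP ?inE // eq_sym.
have [uab|] := boolP (u \in pblock P a :|: pblock P b).
  rewrite (@def_pblock _ _ (pblock P a :|: pblock P b)) ?setU11 //.
  move: uab; rewrite !inE => uab.
  case ua: (u \in pblock P a); first rewrite (pE _ _ ua).
    case ub: (u \in pblock P b); last by rewrite orbF.
    by case: (v \in pblock P a); rewrite ?orbT ?orbF //= andbT.
  move: uab; rewrite ua /= => ub; rewrite ub (pE _ _ ub) /=.
  by rewrite orbC.
rewrite inE negb_or => /andP[/negPf ua /negPf ub]; rewrite ua ub !orbF.
rewrite (@def_pblock _ _ (pblock P u)) //.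
rewrite in_setU1 in_setD pP andbT !inE negb_or.
by rewrite !eq_pblock ?cP ?inE // memC ua memC ub orbT.
Qed.

(** These are the codes of 1' and k', the vertices at which [bullet] glues; [vlast] is meaningful
    for positive order only. *)
Definition vfirst : bool * nat := (true, 0).
Definition vlast p : bool * nat := (true, (order p).-1).

Lemma linked_bullet p q x y : p != pempty -> q != pempty ->
  linked (bullet p q) x y =
  [|| linked (tensor p q) x y,
      linked (tensor p q) x (vlast p) && linked (tensor p q) y (vshift (order p) vfirst)
    | linked (tensor p q) x (vshift (order p) vfirst) && linked (tensor p q) y (vlast p)].
Proof.
case: p q => [[|k] P] [[|m] Q]; rewrite ?pempty_order //= => _ _.
set p : pdiag := existT pdiag_of _ P; set q : pdiag := existT pdiag_of _ Q.
set b : pdiag := Tagged pdiag_of (bullet_of P Q).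
have ob : order b = order (tensor p q) by [].
have [xl|xl] := ltnP x.2 (order b); last first.
  apply/idP/idP => [|/or3P[|/andP[]|/andP[]]] /linked_lt /=; move: xl => /=; lia.
have [yl|yl] := ltnP y.2 (order b); last first.
  apply/idP/idP => [|/or3P[|/andP[_]|/andP[_]]] /linked_lt /=; move: yl => /=; lia.
case/vcodeP: xl => u ->; case/vcodeP: yl => v ->.
have -> : vlast p = vcode (inr (lshift m.+1 ord_max) : vertex (order (tensor p q))) by [].
have -> : vshift (order p) vfirst = vcode (inr (rshift k.+1 ord0) : vertex (order (tensor p q))).
  by [].
rewrite (@linkedE b) !(@linkedE (tensor p q)) /=.
rewrite merge_pblock; last exact: valP (tensor_of P Q).
have memC (s t : vertex (k.+1 + m.+1)) :
    (s \in pblock (val (tensor_of P Q)) t) = (t \in pblock (val (tensor_of P Q)) s).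
  by rewrite -!eq_pblock ?pdiag_trivIset ?pdiag_cover // eq_sym.
congr [|| _, _ | _]; congr andb; exact: memC.
Qed.

Lemma order_bullet p q : order (bullet p q) = order p + order q.
Proof. by case: p q => [[|k] P] [[|m] Q] //=; rewrite addn0. Qed.

Lemma order_join o p q : order (join_by o p q) = order p + order q.
Proof. by case: o; [apply: order_tensor|apply: order_bullet]. Qed.

Lemma join_neq0 o p q : p != pempty -> join_by o p q != pempty.
Proof. by rewrite !pempty_order order_join addn_eq0 => /negPf->. Qed.

Section LinkedJoin.
Variables (o : juncture) (p q : pdiag).
Hypotheses (p_neq0 : p != pempty) (q_neq0 : q != pempty).

Lemma linked_join_ll x y : x.2 < order p -> y.2 < order p ->
  linked (join_by o p q) x y = linked p x y.
Proof.
move=> xl yl; case: o; rewrite /join_by ?linked_bullet // linked_tensor_ll //.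
by rewrite !linked_tensor_lr // andbF orbF.
Qed.

Lemma linked_join_rr x y :
  linked (join_by o p q) (vshift (order p) x) (vshift (order p) y) = linked q x y.
Proof.
case: o; rewrite /join_by ?linked_bullet // linked_tensor_rr //.
have vl : (vlast p).2 < order p by rewrite /vlast /= prednK // order_gt0.
by rewrite !(linked_sym _ _ (vlast p)) !(linked_tensor_lr _ _ vl) andbF /= orbF.
Qed.

(** A link can cross the juncture only through the glued pair k' and (k+1)'; this tells the two
    products apart. *)
Lemma linked_join_lr x y : x.2 < order p ->
  linked (join_by o p q) x (vshift (order p) y) =
  [&& o == Bullet, linked p x (vlast p) & linked q vfirst y].
Proof.
have vl : (vlast p).2 < order p by rewrite /vlast /= prednK // order_gt0.
move=> xl; case: o; rewrite /join_by ?linked_bullet // linked_tensor_lr //=.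
rewrite linked_tensor_rr linked_tensor_ll // linked_tensor_lr //= orbF.
by rewrite (linked_sym q).
Qed.

Lemma linked_join_rl x y : x.2 < order p ->
  linked (join_by o p q) (vshift (order p) y) x =
  [&& o == Bullet, linked p x (vlast p) & linked q vfirst y].
Proof. by rewrite linked_sym; apply: linked_join_lr. Qed.

End LinkedJoin.

Lemma join_ext o p q t : p != pempty -> q != pempty ->
  order t = order p + order q ->
  (forall x y, x.2 < order p -> y.2 < order p -> linked t x y = linked p x y) ->
  (forall x y, x.2 < order q -> y.2 < order q ->
     linked t (vshift (order p) x) (vshift (order p) y) = linked q x y) ->
  (forall x y, x.2 < order p -> y.2 < order q -> linked t x (vshift (order p) y) =
  [&& o == Bullet, linked p x (vlast p) & linked q vfirst y]) ->
  t = join_by o p q.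
Proof.
move=> p0 q0 ot ll rr lr; apply: pdiag_ext => [|x y]; first by rewrite order_join.
case: (vshiftP (order p) x) => [xl|[x' ->]]; case: (vshiftP (order p) y) => [yl|[y' ->]];
  rewrite ot /= ?ltn_add2l => xl' yl'.
- by rewrite linked_join_ll ?ll.
- by rewrite linked_join_lr ?lr.
- by rewrite linked_join_rl // linked_sym ?lr.
- by rewrite linked_join_rr ?rr.
Qed.

Lemma vshiftD i j x : vshift i (vshift j x) = vshift (i + j) x.
Proof. by rewrite /vshift /= addnA. Qed.

Lemma vlast_join o p q : q != pempty ->
  vlast (join_by o p q) = vshift (order p) (vlast q).
Proof. by move=> /order_gt0 q0; rewrite /vlast /vshift /= order_join; congr pair; lia. Qed.

(** The delicate case is a link from [p] to [t]: it crosses both junctures, so it needs two bullets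
    and a block of [q] with both its first and its last primed vertex. *)
Lemma joinA_neq0 o1 o2 p q t : p != pempty -> q != pempty -> t != pempty ->
  join_by o1 p (join_by o2 q t) = join_by o2 (join_by o1 p q) t.
Proof.
move=> p0 q0 t0.
have pq0 := join_neq0 o1 q p0; have qt0 := join_neq0 o2 t q0.
have vl a : a != pempty -> (vlast a).2 < order a by move/order_gt0 => ?; rewrite /= prednK.
have vf a : a != pempty -> vfirst.2 < order a by move/order_gt0.
apply: join_ext => //; first by rewrite !order_join addnA.
- move=> x y; rewrite order_join => xl yl.
  case: (vshiftP (order p) x) => [xp|[x' xE]]; case: (vshiftP (order p) y) => [yp|[y' yE]].
  + by rewrite !linked_join_ll.
  + subst; rewrite /= ltn_add2l in yl; rewrite !linked_join_lr //.
    by rewrite linked_join_ll // vf.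
  + subst; rewrite /= ltn_add2l in xl; rewrite !linked_join_rl //.
    by rewrite linked_join_ll // vf.
  + subst; rewrite /= !ltn_add2l in xl yl; by rewrite !linked_join_rr // linked_join_ll.
- by move=> x y xl yl; rewrite order_join -!vshiftD !linked_join_rr.
- move=> x y; rewrite order_join => xl yl; rewrite vlast_join //.
  case: (vshiftP (order p) x) => [xp|[x' xE]].
    rewrite -vshiftD !linked_join_lr ?vf //.
    by case: (o1 == _); case: (o2 == _); rewrite /= ?andbF ?andbA.
  by subst; rewrite /= ltn_add2l in xl; rewrite -vshiftD !linked_join_rr // linked_join_lr.
Qed.

Lemma tensorp0 p : tensor p pempty = p.
Proof.
apply: pdiag_ext => [|x y]; rewrite order_tensor addn0 // => xl yl.
by rewrite linked_tensor_ll.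
Qed.

Lemma tensor0p p : tensor pempty p = p.
Proof.
apply: pdiag_ext => [//|x y _ _]; rewrite -[RHS](linked_tensor_rr pempty).
by case: x y => [? ?] [? ?].
Qed.

Lemma bullet0p p : bullet pempty p = p.
Proof. by []. Qed.

Lemma bulletp0 p : bullet p pempty = p.
Proof. by case: p => [[|k] P] //; apply/esym/order0_pempty. Qed.

Lemma joinp0 o p : join_by o p pempty = p.
Proof. by case: o; [apply: tensorp0|apply: bulletp0]. Qed.

Lemma join0p o p : join_by o pempty p = p.
Proof. by case: o; [apply: tensor0p|apply: bullet0p]. Qed.

(** The middle factor has to be non-empty: for [q = pempty] the sides are [join_by o1 p t] and
    [join_by o2 p t]. *)
Lemma joinA o1 o2 p q t : q != pempty ->
  join_by o1 p (join_by o2 q t) = join_by o2 (join_by o1 p q) t.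
Proof.
have [->|p0] := eqVneq p pempty; first by rewrite !join0p.
have [->|t0] := eqVneq t pempty; first by rewrite !joinp0.
by move=> q0; apply: joinA_neq0.
Qed.

Lemma vlast_lt p : p != pempty -> (vlast p).2 < order p.
Proof. by move=> /order_gt0 p0; rewrite /= prednK. Qed.

(** The factors are restrictions to the same columns, and the juncture shows in whether [vlast a] is
    linked to the shifted [vfirst]. *)
Lemma join_inj_order o1 o2 a b c d :
  a != pempty -> b != pempty -> c != pempty -> d != pempty ->
  order a = order c -> join_by o1 a b = join_by o2 c d ->
  [/\ o1 = o2, a = c & b = d].
Proof.
move=> a0 b0 c0 d0 ac E.
have obd : order b = order d.
  by apply/eqP; rewrite -(eqn_add2l (order a)) {2}ac -!(order_join o1) E !order_join.
have acE : a = c.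
  apply: pdiag_ext => // x y xl yl.
  by rewrite -(linked_join_ll o1 a0 b0) // E linked_join_ll -?ac.
have bdE : b = d.
  apply: pdiag_ext => // x y xl yl.
  by rewrite -(linked_join_rr o1 a0 b0) // E ac linked_join_rr.
subst c d; split=> //.
have := linked_join_lr o2 a0 b0 vfirst (vlast_lt a0).
rewrite -E linked_join_lr ?vlast_lt // !linked_refl vlast_lt ?order_gt0 //= !andbT.
by case: o1 o2 {E} => -[].
Qed.

(* Levi's lemma for the two products at once. *)
Lemma join_levi o1 o2 a b c d :
  a != pempty -> b != pempty -> c != pempty -> d != pempty ->
  order a < order c -> join_by o1 a b = join_by o2 c d ->
  exists e, [/\ e != pempty, c = join_by o1 a e & b = join_by o2 e d].
Proof.
move=> a0 b0 c0 d0 ac E.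
(* [e] consists of the columns of [c] behind those of [a]. *)
have [|e [oe eE]] := @window_exists c (order a) (order c - order a); first by lia.
have e0 : e != pempty by rewrite pempty_order oe; lia.
have oc : order c = order a + order e by lia.
have ob : order b = order e + order d.
  by apply/eqP; rewrite -(eqn_add2l (order a)) addnA -oc -(order_join o1) E order_join.
have lc x y : x.2 < order c -> y.2 < order c ->
    linked c x y = linked (join_by o1 a b) x y.
  by move=> xl yl; rewrite E linked_join_ll.
have le x y : x.2 < order e -> y.2 < order e -> linked e x y = linked b x y.
  move=> xl yl; rewrite eE -?oe // lc ?oc ?ltn_add2l //.
  by rewrite linked_join_rr.
have vl : vlast c = vshift (order a) (vlast e).
  by move/order_gt0: e0; rewrite /vlast /vshift /= oc => e0; congr pair; lia.
exists e; split=> //; apply: join_ext => //.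
- by move=> x y xl yl; rewrite lc ?linked_join_ll // oc ltn_addr.
- by move=> x y xl yl; rewrite lc ?linked_join_rr ?le // oc ltn_add2l.
- move=> x y xl yl; rewrite lc ?oc ?ltn_add2l ?ltn_addr // linked_join_lr //.
  by rewrite le // order_gt0.
- by move=> x y xl yl; rewrite le.
- move=> x y xl yl; rewrite -(linked_join_rr o1 a0 b0) !vshiftD -oc E.
  by rewrite linked_join_rr.
- move=> x y xl yl; rewrite -(linked_join_rr o1 a0 b0) vshiftD -oc E.
  rewrite linked_join_lr // ?oc ?ltn_add2l //.
  by rewrite vl eE -?oe // vlast_lt.
Qed.

(** * Irreducible diagrams *)

Definition irr o p := p != pempty /\ irreducible (join_by o) p.

Lemma irr_neq0 o p : irr o p -> p != pempty. Proof. by case. Qed.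

Lemma irr_joinN o p q t : p != pempty -> q != pempty -> irr o t -> t <> join_by o p q.
Proof. by move=> p0 q0 [_ it] tE; apply: it; exists p, q. Qed.

Lemma pdiag_ind (P : pdiag -> Prop) :
  (forall p, (forall q, order q < order p -> P q) -> P p) -> forall p, P p.
Proof.
move=> IH p; have [n] := ubnP (order p); elim: n p => // n IHn p /ltnSE pn.
by apply: IH => q qp; apply: IHn; apply: leq_trans qp pn.
Qed.

(** Compare with a presumed cut [a ⊗ b]: at a different place Levi's lemma splits [p] or [q] by [⊗],
    at the same place one juncture would be both [⊗] and [•]. *)
Lemma bullet_irr p q : irr Tensor p -> irr Tensor q -> irr Tensor (bullet p q).
Proof.
move=> ip iq; have [p0 q0] := (irr_neq0 ip, irr_neq0 iq).
split; first exact: (join_neq0 Bullet).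
move=> [a [b [a0 b0 E]]]; case: (ltngtP (order p) (order a)) => pa.
- have [e [e0 _ qE]] := join_levi (o1 := Bullet) (o2 := Tensor) p0 q0 a0 b0 pa E.
  exact: (irr_joinN e0 b0 iq qE).
- have [e [e0 pE _]] := join_levi (o1 := Tensor) (o2 := Bullet) a0 b0 p0 q0 pa (esym E).
  exact: (irr_joinN a0 e0 ip pE).
- by have [] := join_inj_order (o1 := Bullet) (o2 := Tensor) p0 q0 a0 b0 pa E.
Qed.

Lemma bullet_irr_inv p q : p != pempty -> q != pempty -> irr Tensor (bullet p q) ->
  irr Tensor p /\ irr Tensor q.
Proof.
move=> p0 q0 ipq; split; split=> //; move=> [a [b [a0 b0 E]]].
  apply: (irr_joinN (p := a) (q := bullet b q) _ _ ipq) => //; first exact: (join_neq0 Bullet).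
  by rewrite E; apply/esym; apply: (joinA Tensor Bullet).
apply: (irr_joinN (p := bullet p a) (q := b) _ _ ipq) => //; first exact: (join_neq0 Bullet).
by rewrite E; apply: (joinA Bullet Tensor).
Qed.

(* The two decompositions start with irreducible factors of equal order, since
   Levi's lemma would otherwise split the longer one. *)
Lemma join_irr_inj o1 o2 a b c d : irr o2 a -> irr o1 c ->
  b != pempty -> d != pempty -> join_by o1 a b = join_by o2 c d ->
  [/\ o1 = o2, a = c & b = d].
Proof.
move=> ia ic b0 d0 E; have [a0 c0] := (irr_neq0 ia, irr_neq0 ic).
case: (ltngtP (order a) (order c)) => ac; last exact: join_inj_order E.
  (* Levi's lemma cuts [c] at the juncture [o1] of the other side, which is why irreducibility is
     assumed crosswise. *)
  have [e [e0 cE _]] := join_levi a0 b0 c0 d0 ac E.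
  by case: (irr_joinN a0 e0 ic cE).
have [e [e0 aE _]] := join_levi c0 d0 a0 b0 ac (esym E).
by case: (irr_joinN c0 e0 ia aE).
Qed.

(** * Factorization by both products *)

Lemma full_factorization_neq0 p s o : full_factorization p s o -> p != pempty.
Proof.
case: s o => [|x [|y s]] [|j o] [] //= _ ix ->; have [x0 _ _] := ix x (mem_head _ _) => //.
exact: join_neq0.
Qed.

Lemma expression_cat s s' o o' j : size s = (size o).+1 ->
  (forall x, x \in s -> x != pempty) ->
  expression (s ++ s') (o ++ j :: o') =
  join_by j (expression s o) (expression s' o').
Proof.
elim: s o => [|x s IHs] [|j' o] //= -[]; first by case: s {IHs}.
move=> so s0; rewrite IHs //; last by move=> y ys; rewrite s0 // inE ys orbT.
rewrite joinA //; case: s so s0 {IHs} => [|y s] //; case: o => [|j1 o] //= _ s0.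
  by rewrite s0 // !inE eqxx orbT.
by apply: join_neq0; rewrite s0 // !inE eqxx orbT.
Qed.

Lemma full_factorization_cat p q s s' o o' j :
  full_factorization p s o -> full_factorization q s' o' ->
  full_factorization (join_by j p q) (s ++ s') (o ++ j :: o').
Proof.
move=> [so is_ ->] [so' is_' ->]; split.
- by rewrite !size_cat so so' /=; lia.
- by move=> x; rewrite mem_cat => /orP[/is_|/is_'].
- by rewrite expression_cat // => x /is_[].
Qed.

Lemma full_factorization_exists p : p != pempty ->
  exists s o, full_factorization p s o.
Proof.
elim/pdiag_ind: p => p IHp p0.
have step j : ~ irreducible (join_by j) p -> exists s o, full_factorization p s o.
  move=> /contrapT[a [b [a0 b0 pE]]].
  have [a0' b0'] := (order_gt0 a0, order_gt0 b0).
  have [||s [o sP]] := IHp a; rewrite ?pE ?order_join; try lia => //.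
  have [||s' [o' sP']] := IHp b; rewrite ?pE ?order_join; try lia => //.
  by exists (s ++ s'), (o ++ j :: o'); apply: full_factorization_cat.
have [tp|/(step Tensor)//] := pselect (irreducible tensor p).
have [bp|/(step Bullet)//] := pselect (irreducible bullet p).
by exists [:: p], [::]; split=> // x; rewrite inE => /eqP->.
Qed.

Lemma full_factorization_tl p x s j o : full_factorization p (x :: s) (j :: o) ->
  [/\ full_factorization (expression s o) s o, forall j', irr j' x &
      p = join_by j x (expression s o)].
Proof.
move=> [[sz] iz ->]; split=> //; last by have [? ? ?] := iz x (mem_head _ _); case.
by split=> // y yt; apply: iz; rewrite inE yt orbT.
Qed.

Lemma full_factorization_hd p x s : full_factorization p (x :: s) [::] ->
  [/\ p = x, s = [::] & forall j, irr j x].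
Proof.
by case: s => [|y t] [] //= _ iz ->; split=> //; have [? ? ?] := iz x (mem_head _ _); case.
Qed.

(** Factors are irreducible for both products, so [join_irr_inj] strips equal heads whatever the
    junctures are. An irreducible diagram is never a join, which rules out unequal lengths. *)
Lemma full_factorization_uniq p s o s' o' :
  full_factorization p s o -> full_factorization p s' o' -> s = s' /\ o = o'.
Proof.
elim: s o p s' o' => [|x s IHs] o p s' o'; first by case.
case: s' => [|x' s']; first by move=> _ [].
case: o o' => [|j o] [|j' o'].
- by move=> /full_factorization_hd[-> -> _] /full_factorization_hd[-> -> _].
- move=> /full_factorization_hd[-> _ ix].
  move=> /full_factorization_tl[/full_factorization_neq0 e0 ix' xE].
  by case: (irr_joinN (irr_neq0 (ix' j')) e0 (ix j') xE).
- move=> /full_factorization_tl[/full_factorization_neq0 e0 ix' xE].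
  move=> /full_factorization_hd[pE _ ix].
  by case: (irr_joinN (irr_neq0 (ix' j)) e0 (ix j)); rewrite -pE.
- move=> /full_factorization_tl[F ix pE] /full_factorization_tl[F' ix' pE'].
  have [-> -> E] := join_irr_inj (ix j') (ix' j) (full_factorization_neq0 F)
    (full_factorization_neq0 F') (etrans (esym pE) pE').
  by rewrite E in F; have [-> ->] := IHs _ _ _ _ F F'.
Qed.

(** A tensor at the first juncture would split [p]; behind a bullet the remainder is again
    [⊗]-irreducible. *)
Lemma irr_full_factorization p s o : irr Tensor p -> full_factorization p s o ->
  o = nseq (size o) Bullet.
Proof.
elim: s o p => [|x s IHs] [|j o] p ip F //; first by case: F.
have [F' ix pE] := full_factorization_tl F.
have [x0 e0] := (irr_neq0 (ix j), full_factorization_neq0 F').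
case: j F ix pE => F ix pE; first by case: (irr_joinN x0 e0 ip pE).
rewrite pE in ip; have [_ ie] := bullet_irr_inv x0 e0 ip.
by rewrite /= -(IHs _ _ ie F').
Qed.

(** * The refinement order *)

Definition refines (j j' : juncture) := (j' == Tensor) ==> (j == Tensor).

(** The default [Bullet] keeps positions past the end out of [tensor_positions], so inclusion is
    tested juncture by juncture: going up, a tensor may become a bullet, never the converse. *)
Lemma tensor_positions_sub o o' : size o = size o' ->
  (tensor_positions o' `<=` tensor_positions o)%classic <-> all2 refines o o'.
Proof.
elim: o o' => [|j o IHo] [|j' o'] //= => [_|[so]]; first by split=> // _ i.
split.
  move=> sub; apply/andP; split.
    by apply/implyP => /eqP j'T; apply/eqP; apply: (sub 0).
  by apply/(IHo _ so) => i; apply: (sub i.+1).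
move=> /andP[/implyP jj' /(IHo _ so) sub] [|i] /=; last exact: sub.
by move=> j'T; apply/eqP/jj'/eqP.
Qed.

(** By uniqueness one fixed factorization of [p] serves for all [q], so the diagrams above [p] are
    parametrized by juncture sequences. *)
Lemma pdiag_leE p q s o : full_factorization p s o ->
  pdiag_le p q <-> exists o', all2 refines o o' /\ q = expression s o'.
Proof.
move=> F; split.
  move=> [[p0 _]|[s1 [o1 [o' [F1 F' sub]]]]].
    by have := full_factorization_neq0 F; rewrite p0 eqxx.
  have [sE oE] := full_factorization_uniq F F1; subst s1 o1.
  have [so _ _] := F; have [so' _ ->] := F'.
  by exists o'; split=> //; apply/tensor_positions_sub => //; apply/succn_inj; rewrite -so -so'.
move=> [o' [r ->]]; right; exists s, o, o'; have [so is_ _] := F.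
have so' : size o = size o' by move: r; rewrite all2E => /andP[/eqP].
by split=> //; [split=> //; rewrite so so'|apply/tensor_positions_sub].
Qed.

Lemma all2_catP (T U : Type) (r : T -> U -> bool) s1 s2 t :
  all2 r (s1 ++ s2) t <->
  exists t1 t2, [/\ all2 r s1 t1, all2 r s2 t2 & t = t1 ++ t2].
Proof.
split.
  elim: s1 t => [|x s1 IH] [|y t] //=.
  - by move=> h; exists [::], [::].
  - by move=> h; exists [::], (y :: t).
  - by move=> /andP[xy /IH[t1 [t2 [h1 h2 ->]]]]; exists (y :: t1), t2; rewrite /= xy.
move=> [t1 [t2 [h1 h2 ->]]]; elim: s1 t1 h1 => [|x s1 IH] [|y t1] //= /andP[-> h1] /=.
exact: IH.
Qed.

Lemma refines_Bullet n o : all2 refines (nseq n Bullet) o -> o = nseq n Bullet.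
Proof. by elim: n o => [|n IHn] [|[] o] //= /IHn ->. Qed.

Lemma refines_refl o : all2 refines o o.
Proof. by elim: o => //= j o ->; rewrite /refines implybb. Qed.

(** Inside the [⊗]-irreducible [x] all junctures are already bullets and cannot change. Only [j] and
    the junctures of [p] vary, which is the source of the recursion for eta. *)
Lemma pdiag_le_join j x p q : irr Tensor x -> p != pempty ->
  pdiag_le (join_by j x p) q <->
  exists j' t, [/\ refines j j', pdiag_le p t & q = join_by j' x t].
Proof.
move=> ix /full_factorization_exists[s [o F]].
have [sx [ox Fx]] := full_factorization_exists (irr_neq0 ix).
have := irr_full_factorization ix Fx; have [sox isx xE] := Fx => oxE.
have isx0 y : y \in sx -> y != pempty by move=> /isx[].
rewrite (pdiag_leE q (full_factorization_cat j Fx F)); split.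
  move=> [o' [/all2_catP[o1 [[|j' o2] []]]]] //; rewrite oxE => /refines_Bullet o1E.
  move=> /= /andP[jj' r] -> qE; exists j', (expression s o2); split=> //.
    by apply/(pdiag_leE _ F); exists o2.
  by rewrite qE o1E -oxE expression_cat // -xE.
move=> [j' [t [jj' /(pdiag_leE _ F)[o' [r ->]] ->]]].
exists (ox ++ j' :: o'); split; last by rewrite expression_cat // -xE.
by apply/all2_catP; exists ox, (j' :: o'); rewrite refines_refl /= jj'.
Qed.

Lemma pdiag_le_irr x q : irr Tensor x -> pdiag_le x q <-> q = x.
Proof.
move=> ix; have [s [o F]] := full_factorization_exists (irr_neq0 ix).
rewrite (pdiag_leE q F) (irr_full_factorization ix F); have [_ _ xE] := F.
split=> [[o' [/refines_Bullet -> ->]]|->].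
  by rewrite -(irr_full_factorization ix F).
by exists o; rewrite -(irr_full_factorization ix F) refines_refl.
Qed.

Lemma pdiag_le_neq0 p q : p != pempty -> pdiag_le p q -> q != pempty.
Proof.
move=> p0 [[pE _]|[s [o [o' [_ /full_factorization_neq0]]]]] //.
by rewrite pE eqxx in p0.
Qed.

(** Finiteness allows the sums over these sets to be split and rescaled. *)
Lemma pdiag_le_finite p : p != pempty -> finite_set [set q | pdiag_le p q]%classic.
Proof.
move=> /full_factorization_exists[s [o F]].
apply: (sub_finite_set (B := [set` [seq expression s (val o') | o' : (size o).-tuple juncture]]));
  last exact: finite_seq.
move=> q /(pdiag_leE _ F)[o' [r ->]] /=.
have so : size o' == size o by move: r; rewrite all2E => /andP[/eqP->].
by apply/mapP; exists (Tuple so); rewrite ?mem_enum.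
Qed.

(** * Factorization into [⊗]-irreducibles and length *)

Lemma tensors_cons_neq0 x s : x != pempty -> tensors (x :: s) != pempty.
Proof. exact: (join_neq0 Tensor). Qed.

Lemma tensors_eq0 s : (forall x, x \in s -> irr Tensor x) ->
  tensors s = pempty -> s = [::].
Proof.
case: s => // x s /(_ x (mem_head _ _))/irr_neq0 x0 /eqP.
by rewrite (negPf (tensors_cons_neq0 s x0)).
Qed.

Lemma tensor_factorization_uniq s s' :
  (forall x, x \in s -> irr Tensor x) -> (forall x, x \in s' -> irr Tensor x) ->
  tensors s = tensors s' -> s = s'.
Proof.
elim: s s' => [|x s IHs] [|x' s'] is_ is' E; first by [].
- by have := tensors_eq0 is' (esym E).
- by have := tensors_eq0 is_ E.
move: E => /= E.
have [ix ix'] := (is_ x (mem_head _ _), is' x' (mem_head _ _)).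
have {}is_ y : y \in s -> irr Tensor y by move=> ys; apply: is_; rewrite inE ys orbT.
have {}is' y : y \in s' -> irr Tensor y by move=> ys; apply: is'; rewrite inE ys orbT.
have [t0|t0] := eqVneq (tensors s) pempty; have [t0'|t0'] := eqVneq (tensors s') pempty.
- by move: E; rewrite (tensors_eq0 is_ t0) (tensors_eq0 is' t0') !tensorp0 => ->.
- move: E; rewrite t0 tensorp0 => E.
  by case: (irr_joinN (irr_neq0 ix') t0' ix E).
- move: E; rewrite t0' tensorp0 => E.
  by case: (irr_joinN (irr_neq0 ix) t0 ix' (esym E)).
have [_ -> /IHs -> //] := join_irr_inj (o1 := Tensor) (o2 := Tensor) ix ix' t0 t0' E.
Qed.

Lemma tensor_factors_tensors s : (forall x, x \in s -> irr Tensor x) ->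
  tensor_factors (tensors s) = s.
Proof.
move=> is_; rewrite /tensor_factors; case: xgetP => [s' _ [is' E]|/(_ s)[]] //.
by apply/esym/tensor_factorization_uniq.
Qed.

Lemma tensor_factorization_exists p :
  exists s, (forall x, x \in s -> irr Tensor x) /\ p = tensors s.
Proof.
elim/pdiag_ind: p => p IHp.
have [->|p0] := eqVneq p pempty; first by exists [::].
have [ip|/contrapT[a [b [a0 b0 pE]]]] := pselect (irreducible tensor p).
  by exists [:: p]; rewrite /= tensorp0; split=> // x; rewrite inE => /eqP->.
have [a0' b0'] := (order_gt0 a0, order_gt0 b0).
have [|s [is_ sE]] := IHp a; first by rewrite pE order_tensor; lia.
have [|s' [is' s'E]] := IHp b; first by rewrite pE order_tensor; lia.
exists (s ++ s'); split; first by move=> x; rewrite mem_cat => /orP[/is_|/is'].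
rewrite pE sE s'E; elim: s is_ {sE} => [|x s IHs] is_ /=; first exact: tensor0p.
rewrite -IHs; last by move=> y ys; apply: is_; rewrite inE ys orbT.
have [->|ts0] := eqVneq (tensors s) pempty; first by rewrite tensorp0 tensor0p.
by apply/esym; apply: (joinA Tensor Tensor).
Qed.

Lemma plength_tensors s : (forall x, x \in s -> irr Tensor x) ->
  plength (tensors s) = size s.
Proof. by move=> is_; rewrite /plength tensor_factors_tensors. Qed.

Lemma plength_tensor x p : irr Tensor x -> plength (tensor x p) = (plength p).+1.
Proof.
move=> ix; have [s [is_ ->]] := tensor_factorization_exists p.
rewrite -[tensor x _]/(tensors (x :: s)) (plength_tensors is_) plength_tensors //.
by move=> y; rewrite inE => /predU1P[->|/is_].
Qed.

(** The bullet is absorbed into the first [⊗]-factor [y], and [x • y] is again [⊗]-irreducible. *)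
Lemma plength_bullet x p : irr Tensor x -> p != pempty ->
  plength (bullet x p) = plength p.
Proof.
move=> ix; have [[|y s] [is_ ->]] := tensor_factorization_exists p; first by rewrite eqxx.
have iy := is_ y (mem_head _ _) => _.
have -> : bullet x (tensors (y :: s)) = tensors (bullet x y :: s).
  by apply: (joinA Bullet Tensor); case: iy.
have is' z : z \in bullet x y :: s -> irr Tensor z.
  rewrite inE => /predU1P[->|zs]; first exact: bullet_irr.
  by apply: is_; rewrite inE zs orbT.
by rewrite (plength_tensors is_) (plength_tensors is').
Qed.

Lemma plength_irr x : irr Tensor x -> plength x = 1.
Proof.
by move=> ix; rewrite -{1}[x]tensorp0 plength_tensor // (plength_tensors (s := [::])).
Qed.

(** * Recursion for eta *)

Import GRing.Theory.
Local Open Scope ring_scope.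

Section Eta.
Variables (K : fieldType) (r : K) (V : lmodType K).
Implicit Types (f : pdiag -> V) (p x : pdiag).

(* eta r p is eta_val (@Mbasis K) p; since f is arbitrary, operators such as
   M_p |-> M_(x (x) p) act by precomposition. *)
Definition eta_val f p : V :=
  \sum_(s \in [set s | pdiag_le p s]%classic) r ^+ plength s *: f s.

Lemma eta_val_irr f x : irr Tensor x -> eta_val f x = r *: f x.
Proof.
move=> ix; rewrite /eta_val.
rewrite (_ : [set s | pdiag_le x s]%classic = [set x]%classic); last first.
  by apply/seteqP; split=> s /= /(pdiag_le_irr _ ix).
by rewrite fsbig_set1 plength_irr.
Qed.

Lemma pdiag_le_image_inj x p j : x != pempty -> p != pempty ->
  set_inj [set s | pdiag_le p s]%classic (join_by j x).
Proof.
move=> x0 p0 s t; rewrite !in_setE /= => /(pdiag_le_neq0 p0) s0 /(pdiag_le_neq0 p0) t0 E.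
by have [] := join_inj_order x0 s0 x0 t0 erefl E.
Qed.

(** A bullet cannot be coarsened and leaves the length alone, so no power of [r] appears. *)
Lemma eta_val_bullet f x p : irr Tensor x -> p != pempty ->
  eta_val f (bullet x p) = eta_val (f \o bullet x) p.
Proof.
move=> ix p0; have x0 := irr_neq0 ix; rewrite /eta_val.
rewrite (_ : [set s | pdiag_le (bullet x p) s]%classic =
    join_by Bullet x @` [set s | pdiag_le p s])%classic; last first.
  apply/seteqP; split=> s /=.
    by move=> /(pdiag_le_join Bullet _ ix p0)[[] [t []]] // _ ps ->; exists t.
  by move=> [t pt <-]; apply/(pdiag_le_join Bullet _ ix p0); exists Bullet, t.
rewrite fsbig_image; last exact: pdiag_le_image_inj.
apply: eq_fsbigr => s; rewrite in_setE /= => /(pdiag_le_neq0 p0) s0.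
by rewrite plength_bullet.
Qed.

(** The juncture after [x] stays [⊗], which raises the length by one and gives the factor [r], or it
    becomes a bullet. *)
Lemma eta_val_tensor f x p : irr Tensor x -> p != pempty ->
  eta_val f (tensor x p) = r *: eta_val (f \o tensor x) p + eta_val (f \o bullet x) p.
Proof.
move=> ix p0; have x0 := irr_neq0 ix; have fin := pdiag_le_finite p0; rewrite /eta_val.
rewrite (_ : [set s | pdiag_le (tensor x p) s]%classic =
    (join_by Tensor x @` [set s | pdiag_le p s]) `|`
    (join_by Bullet x @` [set s | pdiag_le p s]))%classic; last first.
  apply/seteqP; split=> s /=.
    by move=> /(pdiag_le_join Tensor _ ix p0)[[] [t []]] // _ ps ->; [left|right]; exists t.
  by case=> -[t pt <-]; apply/(pdiag_le_join Tensor _ ix p0);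
    [exists Tensor, t|exists Bullet, t].
rewrite fsbigU0; [|exact: finite_image|exact: finite_image|]; last first.
  move=> s /= [[t pt <-] [t' pt' E]].
  have [t0 t'0] := (pdiag_le_neq0 p0 pt, pdiag_le_neq0 p0 pt').
  by have [] := join_inj_order (o1 := Bullet) (o2 := Tensor) x0 t'0 x0 t0 erefl E.
rewrite !fsbig_image; [|exact: pdiag_le_image_inj..].
congr (_ + _).
  rewrite !fsbig_finite //= scaler_sumr; apply: eq_bigr => s _.
  by rewrite plength_tensor // exprS scalerA.
apply: eq_fsbigr => s; rewrite in_setE /= => /(pdiag_le_neq0 p0) s0.
by rewrite plength_bullet.
Qed.

(** For [⊗]-irreducible entries and non-empty [s] these are the [⊗]-factors of the diagrams above
    [tensors s]. The head stays alone or is glued to the next factor; [pmap] drops the second option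
    when nothing follows. *)
Fixpoint coarsenings (s : seq pdiag) : seq (seq pdiag) :=
  if s is x :: s' then
    [seq x :: C | C <- coarsenings s'] ++
    pmap (fun C => if C is c :: C' then Some (bullet x c :: C') else None) (coarsenings s')
  else [:: [::]].

(** Unlike in [eta_val], the summand sees the list of [⊗]-factors instead of their product, as
    stuffling requires. *)
Definition coarse_sum (s : seq pdiag) (F : seq pdiag -> V) : V :=
  \sum_(C <- coarsenings s) r ^+ size C *: F C.

Lemma coarse_sum_cons x s F : coarse_sum (x :: s) F =
  r *: coarse_sum s (fun C => F (x :: C)) +
  coarse_sum s (fun C => if C is c :: C' then F (bullet x c :: C') else 0).
Proof.
rewrite /coarse_sum big_cat big_map big_pmap /= scaler_sumr; congr (_ + _).
  by apply: eq_bigr => C _; rewrite exprS scalerA.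
by apply: eq_bigr => -[|c C] _ //=; rewrite scaler0.
Qed.

Lemma coarse_sum_nil F : coarse_sum [::] F = F [::].
Proof. by rewrite /coarse_sum big_seq1 scale1r. Qed.

Lemma coarsenings_irr s C : (forall x, x \in s -> irr Tensor x) ->
  C \in coarsenings s -> forall c, c \in C -> irr Tensor c.
Proof.
elim: s C => [|x s IHs] C is_ /=; first by rewrite inE => /eqP->.
have ix := is_ x (mem_head _ _).
have {}is_ y : y \in s -> irr Tensor y by move=> ys; apply: is_; rewrite inE ys orbT.
rewrite mem_cat mem_pmap => /orP[/mapP[C' C's ->] c|/mapP[[|c C'] // C's [->] d]].
  by rewrite inE => /predU1P[->//|]; apply: IHs C's c.
have IH := IHs _ is_ C's; rewrite inE => /predU1P[->|dC].
  by apply: bullet_irr => //; apply/IH/mem_head.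
by apply: IH; rewrite inE dC orbT.
Qed.

Lemma coarsenings_neq0 s C : C \in coarsenings s -> (C == [::]) = (s == [::]).
Proof.
case: s => [|x s] /=; first by rewrite inE => /eqP->.
by rewrite mem_cat mem_pmap => /orP[/mapP[C' _ ->]|/mapP[[|c C'] // C's [->]]].
Qed.

Lemma eq_coarse_sum s F G : {in coarsenings s, F =1 G} -> coarse_sum s F = coarse_sum s G.
Proof. by move=> FG; apply: eq_big_seq => C /FG ->. Qed.

(** Both sides obey the same recursion on the head, by [eta_val_tensor] and [coarse_sum_cons];
    [x • (c ⊗ p) = (x • c) ⊗ p] for non-empty [c] matches the bullet terms. *)
Lemma eta_val_tensors f s : s != [::] -> (forall x, x \in s -> irr Tensor x) ->
  eta_val f (tensors s) = coarse_sum s (f \o tensors).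
Proof.
elim: s f => [//|x [|y s] IHs] f _ is_.
  rewrite coarse_sum_cons !coarse_sum_nil addr0 [tensors _]tensorp0 eta_val_irr /= ?tensorp0 //.
  exact/is_/mem_head.
have ix := is_ x (mem_head _ _).
have {}is_ z : z \in y :: s -> irr Tensor z by move=> zs; apply: is_; rewrite inE zs orbT.
rewrite coarse_sum_cons [tensors _]/(tensor x (tensors (y :: s))) eta_val_tensor //; last first.
  exact/tensors_cons_neq0/irr_neq0/is_/mem_head.
rewrite !IHs //; congr (_ + _).
(* The empty list, where [coarse_sum_cons] puts 0, is no coarsening of [y :: s]. *)
apply: eq_coarse_sum => -[|c C] CC; first by have := coarsenings_neq0 CC.
rewrite /=; congr f; apply: (joinA Bullet Tensor).
exact/irr_neq0/(coarsenings_irr is_ CC)/mem_head.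
Qed.

End Eta.

(** * Stuffles *)

Section Stuffles.
(* z stands for the empty diagram that pads the two sequences. *)
Variables (T : eqType) (z : T).
Implicit Types (x y : T) (u v C D : seq T).

Fixpoint stuffle_list C : seq T -> seq (seq T * seq T) :=
  fix stuffle_list_C D :=
  match C, D with
  | [::], [::] => [:: ([::], [::])]
  | [::], d :: D' => [seq (z :: e.1, d :: e.2) | e <- stuffle_list_C D']
  | c :: C', [::] => [seq (c :: e.1, z :: e.2) | e <- stuffle_list C' [::]]
  | c :: C', d :: D' =>
    [seq (c :: e.1, z :: e.2) | e <- stuffle_list C' D] ++
    [seq (z :: e.1, d :: e.2) | e <- stuffle_list_C D'] ++
    [seq (c :: e.1, d :: e.2) | e <- stuffle_list C' D']
  end.

Lemma map_cons2_uniq x y (s : seq (seq T * seq T)) : uniq s ->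
  uniq [seq (x :: e.1, y :: e.2) | e <- s].
Proof. by rewrite map_inj_uniq // => -[u1 u2] [v1 v2] /= [-> ->]. Qed.

Lemma mem_map_cons2 x y x' y' s u v :
  ((x' :: u, y' :: v) \in [seq (x :: e.1, y :: e.2) | e <- s]) =
  [&& x' == x, y' == y & (u, v) \in s].
Proof.
apply/mapP/and3P => [[[u' v'] us [-> -> -> ->]]|[/eqP-> /eqP-> us]]; first by rewrite !eqxx.
by exists (u, v).
Qed.

(** As [z] is no entry, the first pairs [(c, z)], [(z, d)], [(c, d)] tell the three groups apart.
    The product sums over a set, so the list must be free of repetitions. *)
Lemma stuffle_list_uniq C D : z \notin C -> z \notin D -> uniq (stuffle_list C D).
Proof.
elim: C D => [|c C IHC]; elim=> [|d D IHD] //=; rewrite ?inE ?negb_or.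
- by move=> zC /andP[_ zD]; apply/map_cons2_uniq/IHD.
- by move=> /andP[_ zC] _; apply/map_cons2_uniq/IHC.
move=> /andP[zc zC] /andP[zd zD].
rewrite !cat_uniq !map_cons2_uniq ?IHC ?IHD ?inE ?negb_or ?zd ?zc //= !andbT; apply/andP; split.
  apply/hasPn => -[u v]; rewrite mem_cat => /orP[]/mapP[e _ [-> ->]];
    by rewrite mem_map_cons2 ?(eq_sym d) ?(negPf zd) ?(negPf zc) ?andbF.
by apply/hasPn => -[u v] /mapP[e _ [-> ->]]; rewrite mem_map_cons2 eq_sym (negPf zc).
Qed.

Lemma mem_stuffle_list_cons C D x y u v : ((x :: u, y :: v) \in stuffle_list C D) =
  [|| (y == z) && (if C is c :: C' then (x == c) && ((u, v) \in stuffle_list C' D) else false),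
      (x == z) && (if D is d :: D' then (y == d) && ((u, v) \in stuffle_list C D') else false)
    | (if C is c :: C' then if D is d :: D' then
        [&& x == c, y == d & (u, v) \in stuffle_list C' D'] else false else false)].
Proof.
case: C D => [|c C] [|d D] /=; rewrite ?mem_cat ?mem_map_cons2 ?andbF ?orbF //=.
  by rewrite andbCA.
by rewrite andbCA.
Qed.

Lemma mem_stuffle_list_nil C D u v : (u == [::]) || (v == [::]) ->
  ((u, v) \in stuffle_list C D) = [&& u == [::], v == [::], C == [::] & D == [::]].
Proof.
have memN x y s : (u == [::]) || (v == [::]) ->
    ((u, v) \in [seq (x :: e.1, y :: e.2) | e <- s]) = false.
  by move=> uv; apply/negP => /mapP[e _ [uE vE]]; rewrite uE vE in uv.
by move=> uv; case: C D => [|c C] [|d D] /=; rewrite ?mem_cat ?memN ?inE ?andbF ?andbT.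
Qed.

Lemma mem_stuffle_list C D u v : z \notin C -> z \notin D ->
  ((u, v) \in stuffle_list C D) =
  [&& size u == size v, filter (predC1 z) u == C, filter (predC1 z) v == D
    & all (fun xy => ~~ ((xy.1 == z) && (xy.2 == z))) (zip u v)].
Proof.
have zhd c E : z \notin c :: E -> (z == c) = false by rewrite inE negb_or => /andP[/negPf].
elim: u v C D => [|x u IHu] [|y v] C D C0 D0.
- by rewrite mem_stuffle_list_nil //= eq_sym [X in _ && X]eq_sym andbT.
- by rewrite mem_stuffle_list_nil.
- by rewrite mem_stuffle_list_nil.
rewrite mem_stuffle_list_cons /= eqSS.
(* Which entries of the first pair equal [z] decides the group of the list; the pair [(z, z)] is
   excluded on both sides. *)
have [->|x0] := eqVneq x z; have [->|y0] := eqVneq y z => /=; rewrite ?andbF ?andbT /= ?orbF.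
- by case: C C0 => [|c C] C0; case: D D0 => [|d D] D0 //; rewrite ?(zhd _ _ C0) ?(zhd _ _ D0).
- case: D D0 => [|d D]; rewrite ?andbF ?inE ?negb_or //=; first by case: C C0.
  move=> /andP[zd zD]; rewrite IHu // eqseq_cons.
  have -> : (if C is c :: C' then [&& z == c, y == d & (u, v) \in stuffle_list C' D] else false) =
      false.
    by case: C C0 {IHu} => // c C; rewrite inE negb_or => /andP[/negPf->].
  by rewrite orbF; case: (y == d); rewrite /= ?andbF.
- case: C C0 => [|c C]; rewrite ?andbF ?inE ?negb_or //=.
  move=> /andP[zc zC]; rewrite IHu // eqseq_cons.
  have -> : (if D is d :: D' then [&& x == c, z == d & (u, v) \in stuffle_list C D'] else false) =
      false.
    by case: D D0 {IHu} => // d D; rewrite inE negb_or => /andP[/negPf-> _]; rewrite andbF.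
  by rewrite orbF; case: (x == c); rewrite /= ?andbF.
- case: C C0 => [|c C]; case: D D0 => [|d D]; rewrite ?andbF ?inE ?negb_or //=.
  move=> /andP[zd zD] /andP[zc zC]; rewrite IHu // !eqseq_cons.
  by case: (x == c); case: (y == d); rewrite /= ?andbF.
Qed.

End Stuffles.

Lemma bullet_eq0 p q : (bullet p q == pempty) = (p == pempty) && (q == pempty).
Proof. by rewrite !pempty_order order_bullet addn_eq0. Qed.

Lemma stufflesE C D : pempty \notin C -> pempty \notin D ->
  stuffles C D = [set` stuffle_list pempty C D]%classic.
Proof.
move=> C0 D0; apply/seteqP; split=> -[u v].
  move=> [/= uv <- <- nz]; rewrite mem_stuffle_list ?mem_filter /= ?eqxx // uv eqxx /=.
  by rewrite -(eq_all (a1 := fun xy => bullet xy.1 xy.2 != pempty)) // => xy; rewrite bullet_eq0.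
rewrite /= mem_stuffle_list // => /and4P[/eqP uv /eqP uC /eqP vD nz]; split=> //=.
rewrite (eq_all (a2 := fun xy => ~~ ((xy.1 == pempty) && (xy.2 == pempty)))) // => xy.
by rewrite bullet_eq0.
Qed.

Definition stuffle_value (e : seq pdiag * seq pdiag) : pdiag :=
  tensors [seq bullet xy.1 xy.2 | xy <- zip e.1 e.2].

(** * Products of two etas *)

Section Products.
Variables (K : fieldType) (r : K) (V : lmodType K).
Implicit Types (f : pdiag -> V) (A B C D : seq pdiag).

Definition stuffle_sum f C D : V := \sum_(e <- stuffle_list pempty C D) f (stuffle_value e).

(* The terms of stuffle_sum sorted by their first pair: (c, empty), (empty, d)
   or (c, d). *)
Definition stuffle_suml f C D : V :=
  if C is c :: C' then stuffle_sum (f \o tensor c) C' D else 0.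
Definition stuffle_sumr f C D : V :=
  if D is d :: D' then stuffle_sum (f \o tensor d) C D' else 0.
Definition stuffle_sumlr f C D : V :=
  if C is c :: C' then
    if D is d :: D' then stuffle_sum (f \o tensor (bullet c d)) C' D' else 0 else 0.

Lemma stuffle_sum_nil f : stuffle_sum f [::] [::] = f pempty.
Proof. by rewrite /stuffle_sum big_seq1. Qed.

Lemma stuffle_sum_rec f C D : (C != [::]) || (D != [::]) ->
  stuffle_sum f C D = stuffle_suml f C D + stuffle_sumr f C D + stuffle_sumlr f C D.
Proof.
case: C D => [|c C] [|d D] // _; rewrite /stuffle_sum /= ?big_cat /= !big_map;
  rewrite ?addr0 ?add0r ?addrA //.
- by apply: eq_bigr => e _; rewrite /stuffle_value /= bulletp0.
- by congr (_ + _ + _); apply: eq_bigr => e _; rewrite /stuffle_value /= bulletp0.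
Qed.

(** For [f = @Mbasis K] this is the product of two etas, by [star_eta]; the variants below keep only
    the stuffles with one type of first pair. *)
Definition eta_prod f A B : V :=
  coarse_sum r A (fun C => coarse_sum r B (stuffle_sum f C)).
Definition eta_prodl f A B : V :=
  coarse_sum r A (fun C => coarse_sum r B (stuffle_suml f C)).
Definition eta_prodr f A B : V :=
  coarse_sum r A (fun C => coarse_sum r B (stuffle_sumr f C)).
Definition eta_prodlr f A B : V :=
  coarse_sum r A (fun C => coarse_sum r B (stuffle_sumlr f C)).

Lemma coarse_sumD A F G :
  coarse_sum r A (fun C => F C + G C : V) = coarse_sum r A F + coarse_sum r A G.
Proof. by rewrite -big_split; apply: eq_bigr => C _; rewrite scalerDr. Qed.

Lemma coarse_sumZ A a F :
  coarse_sum r A (fun C => a *: F C : V) = a *: coarse_sum r A F.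
Proof. by rewrite scaler_sumr; apply: eq_bigr => C _; rewrite !scalerA mulrC. Qed.

Lemma coarse_sum0 A : coarse_sum r A (fun=> 0 : V) = 0.
Proof. by rewrite /coarse_sum big1 // => C _; rewrite scaler0. Qed.

Lemma eta_prod_nil f : eta_prod f [::] [::] = f pempty.
Proof. by rewrite /eta_prod !coarse_sum_nil stuffle_sum_nil. Qed.

Lemma eta_prod_rec f A B : (A != [::]) || (B != [::]) ->
  eta_prod f A B = eta_prodl f A B + eta_prodr f A B + eta_prodlr f A B.
Proof.
move=> AB; rewrite /eta_prod /eta_prodl /eta_prodr /eta_prodlr -!coarse_sumD.
apply: eq_coarse_sum => C CA; rewrite -!coarse_sumD.
apply: eq_coarse_sum => D DB; apply: stuffle_sum_rec.
by rewrite (coarsenings_neq0 CA) (coarsenings_neq0 DB).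
Qed.

Lemma tensor_bullet x c p : c != pempty ->
  tensor (bullet x c) p = bullet x (tensor c p).
Proof. by move=> c0; apply/esym; apply: (joinA Bullet Tensor). Qed.

Lemma eta_prodl_nil f B : eta_prodl f [::] B = 0.
Proof. by rewrite /eta_prodl coarse_sum_nil coarse_sum0. Qed.

Lemma eta_prodr_nil f A : eta_prodr f A [::] = 0.
Proof.
rewrite /eta_prodr -[RHS](coarse_sum0 A).
by apply: eq_coarse_sum => C _; rewrite coarse_sum_nil.
Qed.

Lemma eta_prodlr_nil f B : eta_prodlr f [::] B = 0.
Proof. by rewrite /eta_prodlr coarse_sum_nil coarse_sum0. Qed.

(** If [x] is a block by itself, an unrestricted product follows; if it is glued to [c], then
    [(x • c) ⊗ p = x • (c ⊗ p)] keeps the type of the first pair. *)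
Lemma eta_prodl_cons f x A B : (forall a, a \in A -> irr Tensor a) ->
  eta_prodl f (x :: A) B =
  r *: eta_prod (f \o tensor x) A B + eta_prodl (f \o bullet x) A B.
Proof.
move=> iA; rewrite /eta_prodl coarse_sum_cons; congr (_ + _).
apply: eq_coarse_sum => -[|c C] CA; first by rewrite coarse_sum0.
have c0 := irr_neq0 (coarsenings_irr iA CA (mem_head _ _)).
apply: eq_coarse_sum => D _; apply: eq_bigr => e _ /=.
by rewrite tensor_bullet.
Qed.

Lemma eta_prodr_cons f y A B : (forall b, b \in B -> irr Tensor b) ->
  eta_prodr f A (y :: B) =
  r *: eta_prod (f \o tensor y) A B + eta_prodr (f \o bullet y) A B.
Proof.
move=> iB; rewrite /eta_prodr /eta_prod -coarse_sumZ -coarse_sumD.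
apply: eq_coarse_sum => C _; rewrite coarse_sum_cons; congr (_ + _).
apply: eq_coarse_sum => -[|d D] DB //.
have d0 := irr_neq0 (coarsenings_irr iB DB (mem_head _ _)).
by apply: eq_bigr => e _ /=; rewrite tensor_bullet.
Qed.

(** If the block [x] alone meets [d], the value [x • d] looks like a stuffle starting with [d],
    placed behind [x •]; the extra [r] is the weight of the block [x]. Otherwise
    [(x • c) • d = x • (c • d)]. *)
Lemma eta_prodlr_cons f x A B : (forall a, a \in A -> irr Tensor a) ->
  (forall b, b \in B -> irr Tensor b) ->
  eta_prodlr f (x :: A) B =
  r *: eta_prodr (f \o bullet x) A B + eta_prodlr (f \o bullet x) A B.
Proof.
move=> iA iB; rewrite /eta_prodlr /eta_prodr coarse_sum_cons; congr (_ + _).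
  congr (_ *: _); apply: eq_coarse_sum => C _; apply: eq_coarse_sum => -[|d D] DB //.
  have d0 := irr_neq0 (coarsenings_irr iB DB (mem_head _ _)).
  by apply: eq_bigr => e _ /=; rewrite tensor_bullet.
apply: eq_coarse_sum => -[|c C] CA; first by rewrite coarse_sum0.
have c0 := irr_neq0 (coarsenings_irr iA CA (mem_head _ _)).
apply: eq_coarse_sum => -[|d D] DB //; apply: eq_bigr => e _ /=.
rewrite -tensor_bullet; last exact: (join_neq0 Bullet).
by congr (f (tensor _ _)); apply/esym; apply: (joinA Bullet Bullet).
Qed.

End Products.

(** * Shuffles and sums read letter by letter *)

Section Words.
Variables (I J : Type).
Implicit Types (a : seq I) (b : seq J) (w : seq (I + J)).

Fixpoint shuffles a : seq J -> seq (seq (I + J)) :=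
  fix shuffles_a b :=
  match a, b with
  | [::], [::] => [:: [::]]
  | [::], j :: b' => [seq inr j :: w | w <- shuffles_a b']
  | i :: a', [::] => [seq inl i :: w | w <- shuffles a' [::]]
  | i :: a', j :: b' =>
    [seq inl i :: w | w <- shuffles a' b] ++ [seq inr j :: w | w <- shuffles_a b']
  end.

Variables (K : fieldType) (r : K) (V : lmodType K) (g : I + J -> pdiag).
Implicit Types f : pdiag -> V.

(** The contribution of one bullet in the theorem: [(-1)(-q) = r - 1] if counted by [n2], [-1] if
    counted by [n3], and 0 if not admissible. *)
Definition bullet_coef (x y : I + J) : K :=
  match x, y with
  | inl _, inr _ => r - 1
  | inr _, inl _ => -1
  | _, _ => 0
  end.

(** For non-empty [w] with [⊗]-irreducible letters this is the weighted sum of [eta_val] over all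
    junctures. The 1 beside [bullet_coef] comes from a tensor that eta coarsens to a bullet. *)
Fixpoint word_sum f w : V :=
  if w is x :: w' then
    r *: word_sum (f \o tensor (g x)) w' +
    (if w' is y :: _ then (1 + bullet_coef x y) *: word_sum (f \o bullet (g x)) w' else 0)
  else f pempty.

Definition shuffle_sum f a b : V := \sum_(w <- shuffles a b) word_sum f w.
Definition shuffle_suml f a b : V :=
  if a is i :: a' then \sum_(w <- shuffles a' b) word_sum f (inl i :: w) else 0.
Definition shuffle_sumr f a b : V :=
  if b is j :: b' then \sum_(w <- shuffles a b') word_sum f (inr j :: w) else 0.

Lemma big_shuffles a b (F : seq (I + J) -> V) :
  \sum_(w <- shuffles a b) F w =
  (if a is i :: a' then \sum_(w <- shuffles a' b) F (inl i :: w) else 0) +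
  (if b is j :: b' then \sum_(w <- shuffles a b') F (inr j :: w) else 0) +
  (if a is [::] then if b is [::] then F [::] else 0 else 0) :> V.
Proof.
case: a b => [|i a] [|j b] /=; rewrite ?big_cat ?big_map ?big_seq1 ?addr0 ?add0r //.
Qed.

(** Behind a [rho] the bullet has total coefficient 1 before another [rho] and [1 + (r - 1) = r]
    before a [sigma]. *)
Lemma shuffle_suml_cons f i a b :
  shuffle_suml f (i :: a) b = r *: shuffle_sum (f \o tensor (g (inl i))) a b +
  shuffle_suml (f \o bullet (g (inl i))) a b +
  r *: shuffle_sumr (f \o bullet (g (inl i))) a b.
Proof.
rewrite /shuffle_suml /= big_split /= -scaler_sumr -addrA; congr (_ + _).
(* [z] belongs to the empty remaining word, before which there is no juncture. *)
rewrite big_shuffles; set z := (X in _ + X = _).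
have {z}-> : z = 0 by rewrite /z; case: (a) (b) => [|? ?] [].
rewrite addr0; congr (_ + _).
  by case: a => [|i' a] //; apply: eq_bigr => w _; rewrite /= addr0 scale1r.
case: b => [|j b]; first by rewrite scaler0.
by rewrite scaler_sumr; apply: eq_bigr => w _; rewrite /= addrC subrK.
Qed.

(** Before a [rho] the coefficient is [1 - 1 = 0], so behind the bullet only words starting with a
    [sigma] survive. *)
Lemma shuffle_sumr_cons f j a b :
  shuffle_sumr f a (j :: b) = r *: shuffle_sum (f \o tensor (g (inr j))) a b +
  shuffle_sumr (f \o bullet (g (inr j))) a b.
Proof.
rewrite /shuffle_sumr big_split /= -scaler_sumr; congr (_ + _).
rewrite big_shuffles; set z := (X in _ + X = _).
have {z}-> : z = 0 by rewrite /z; case: (a) (b) => [|? ?] [].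
rewrite addr0 -[RHS]add0r; congr (_ + _).
  by case: a => [|i a] //; rewrite big1 // => w _; rewrite /= subrr scale0r.
by case: b => [|j' b] //; apply: eq_bigr => w _; rewrite /= addr0 scale1r.
Qed.

Lemma shuffle_sum_nil f : shuffle_sum f [::] [::] = f pempty.
Proof. by rewrite /shuffle_sum big_seq1. Qed.

Lemma shuffle_sum_rec f a b : ~~ nilp a || ~~ nilp b ->
  shuffle_sum f a b = shuffle_suml f a b + shuffle_sumr f a b.
Proof.
move=> ab; rewrite /shuffle_sum big_shuffles -[RHS]addr0; congr (_ + _).
by case: a b ab => [|? ?] [|? ?].
Qed.

Hypothesis g_irr : forall x, irr Tensor (g x).

(** The pairs [(c, empty)] and [(c, d)] both begin with a letter of [a], so their sum matches the
    words that do. The induction on total size is simultaneous and leaves [f] free, since each step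
    composes [f] with a product. *)
Lemma eta_prod_shuffle f a b :
  let A := [seq g (inl i) | i <- a] in let B := [seq g (inr j) | j <- b] in
  [/\ eta_prodl r f A B + eta_prodlr r f A B = shuffle_suml f a b,
      eta_prodr r f A B = shuffle_sumr f a b &
      eta_prod r f A B = shuffle_sum f a b].
Proof.
have [n] := ubnP (size a + size b); elim: n a b f => // n IHn a b f /ltnSE ab A B.
have irrA (s : seq I) p : p \in [seq g (inl i) | i <- s] -> irr Tensor p.
  by elim: s => //= i s IHs; rewrite inE => /predU1P[->|/IHs].
have irrB (s : seq J) p : p \in [seq g (inr j) | j <- s] -> irr Tensor p.
  by elim: s => //= i s IHs; rewrite inE => /predU1P[->|/IHs].
have El : eta_prodl r f A B + eta_prodlr r f A B = shuffle_suml f a b.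
  rewrite {}/A; case: a ab => [|i a] ab; first by rewrite eta_prodl_nil eta_prodlr_nil addr0.
  rewrite shuffle_suml_cons /= eta_prodl_cons ?eta_prodlr_cons;
    [|exact: irrA|exact: irrB|exact: irrA].
  have [_ _ ->] := IHn a b (f \o tensor (g (inl i))) ab.
  have [E1 E2 _] := IHn a b (f \o bullet (g (inl i))) ab.
  (* The [r *: eta_prodr] coming from the pairs [(c, d)] accounts for the words in which a [sigma]
     follows the first [rho]. *)
  by rewrite -E1 -E2 -!addrA; congr (_ + (_ + _)); rewrite addrC.
have Er : eta_prodr r f A B = shuffle_sumr f a b.
  rewrite {El}/B; case: b ab => [|j b]; first by rewrite eta_prodr_nil.
  rewrite addnS shuffle_sumr_cons /= => ab; rewrite eta_prodr_cons; last exact: irrB.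
  have [_ _ ->] := IHn a b (f \o tensor (g (inr j))) ab.
  by have [_ -> _] := IHn a b (f \o bullet (g (inr j))) ab.
split=> //; have [/andP[/nilP a0 /nilP b0]|ab0] := boolP (nilp a && nilp b).
  by rewrite /A /B a0 b0 eta_prod_nil shuffle_sum_nil.
rewrite negb_and in ab0; rewrite eta_prod_rec; last first.
  by case: a b @A @B ab0 {El Er ab} => [|? ?] [|? ?].
by rewrite shuffle_sum_rec // -El -Er addrAC.
Qed.

End Words.

(** * Words and junctures *)

Lemma mem_shuffles (I J : eqType) (a : seq I) (b : seq J) (w : seq (I + J)) :
  (w \in shuffles a b) =
  (pmap (fun x => if x is inl i then Some i else None) w == a) &&
  (pmap (fun x => if x is inr j then Some j else None) w == b).
Proof.
have mem_map_cons (x y : I + J) v s :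
    (y :: v \in [seq x :: u | u <- s]) = (y == x) && (v \in s).
  by apply/mapP/andP => [[u us [-> ->]]|[/eqP-> vs]]; [rewrite eqxx|exists v].
have nil_mem_map (x : I + J) s : ([::] \in [seq x :: u | u <- s]) = false.
  by apply/negP => /mapP[].
elim: w a b => [|[i|j] w IHw] [|i' a] [|j' b];
  rewrite /= ?inE ?mem_cat ?nil_mem_map ?mem_map_cons //= ?IHw ?eqseq_cons;
  rewrite ?andbF //= ?orbF ?andbA //.
- rewrite -[w \in _]/(w \in shuffles [::] b) IHw andbA; congr andb; apply: andbC.
- rewrite -[w \in _]/(w \in shuffles (i' :: a) b) IHw andbA; congr andb; apply: andbC.
Qed.

Lemma shuffles_uniq (I J : eqType) (a : seq I) (b : seq J) : uniq (shuffles a b).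
Proof.
have inj (x : I + J) : injective (cons x) by move=> u v [].
elim: a b => [|i a IHa]; elim=> [|j b IHb] //=; rewrite ?map_inj_uniq //.
rewrite cat_uniq !map_inj_uniq // IHa IHb andbT /=.
by apply/hasPn => w /mapP[v _ ->]; apply/negP => /mapP[].
Qed.

Lemma sum_is_shuffle (n m : nat) (V : nmodType) (F : seq ('I_n + 'I_m) -> V) :
  \sum_(w : word n m | is_shuffle w) F w =
  \sum_(w <- shuffles (enum 'I_n) (enum 'I_m)) F w.
Proof.
rewrite -big_filter -(big_map val xpredT F).
apply/perm_big/uniq_perm; rewrite ?shuffles_uniq ?(map_inj_uniq val_inj);
  rewrite ?filter_uniq ?index_enum_uniq //.
move=> w; rewrite mem_shuffles; apply/mapP/idP => [[v]|w_sh].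
  by rewrite mem_filter => /andP[sh _ ->].
(* Each letter survives in exactly one of the two projections, so their lengths add up. *)
have size_w : size w = (n + m)%N.
  rewrite -{2}(size_enum_ord n) -{2}(size_enum_ord m); case/andP: w_sh => /eqP<- /eqP<-.
  by elim: (w) => // -[i|j] u IHu /=; rewrite IHu ?addnS.
by exists (Tuple (introT eqP size_w)) => //; rewrite mem_filter mem_index_enum andbT.
Qed.

Lemma big_juncture_tuple (V : nmodType) k (F : k.+1.-tuple juncture -> V) :
  \sum_o F o = \sum_(o : k.-tuple juncture) F [tuple of Tensor :: o] +
    \sum_(o : k.-tuple juncture) F [tuple of Bullet :: o].
Proof.
rewrite (bigID (fun o : k.+1.-tuple juncture => thead o == Tensor)) /=; congr (_ + _).
  rewrite (reindex (fun o : k.-tuple juncture => [tuple of Tensor :: o])) /=.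
    by apply: eq_bigl => o; rewrite theadE eqxx.
  exists (fun o : k.+1.-tuple juncture => [tuple of behead o]) => o.
    by move=> _; apply: val_inj.
  by rewrite inE; case/tupleP: o => j o; rewrite theadE => /eqP->; apply: val_inj.
rewrite (reindex (fun o : k.-tuple juncture => [tuple of Bullet :: o])) //=.
exists (fun o : k.+1.-tuple juncture => [tuple of behead o]) => o.
  by move=> _; apply: val_inj.
by rewrite inE; case/tupleP: o => -[] o; rewrite theadE // => _; apply: val_inj.
Qed.

Section JunctureSums.
Variables (I J : Type) (K : fieldType) (r : K).
Implicit Types (w : seq (I + J)) (o : seq juncture).

(** A bullet that is not admissible makes the product vanish, so sums may run over all junctures. *)
Fixpoint juncture_coef w o : K :=
  match w, o with
  | x :: ((y :: _) as w'), j :: o' =>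
    (if j is Bullet then bullet_coef r x y else 1) * juncture_coef w' o'
  | _, _ => 1
  end.

(** At the first juncture a tensor yields a term [r] with [x ⊗] and a term 1 with [x •], a bullet
    yields [bullet_coef] with [x •]; the bullet terms add up to [1 + bullet_coef]. *)
Lemma word_sum_tuple (V : lmodType K) (g : I + J -> pdiag) (f : pdiag -> V) k w :
  (forall x, irr Tensor (g x)) -> size w = k.+1 ->
  word_sum r g f w = \sum_(o : k.-tuple juncture)
    juncture_coef w o *: eta_val r f (expression [seq g x | x <- w] o).
Proof.
move=> ig; elim: k w f => [|k IHk] [|x [|y w]] f // => [_|[sw]].
  rewrite /= (big_pred1 [tuple]) /=; last by move=> o; apply/esym/eqP/tuple0.
  by rewrite scale1r eta_val_irr // addr0 tensorp0.
have e0 o : expression [seq g x | x <- y :: w] o != pempty.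
  have y0 := irr_neq0 (ig y).
  by case: w {sw} => [|z w] /=; case: o => [|j o] //=; exact: join_neq0.
have -> : word_sum r g f (x :: y :: w) = r *: word_sum r g (f \o tensor (g x)) (y :: w) +
    (1 + bullet_coef r x y) *: word_sum r g (f \o bullet (g x)) (y :: w) by [].
rewrite !(IHk (y :: w)) /= ?sw //.
rewrite big_juncture_tuple /= !scaler_sumr -!big_split /=; apply: eq_bigr => o _.
rewrite (eta_val_tensor _ _ (ig x) (e0 o)) (eta_val_bullet _ _ (ig x) (e0 o)) mul1r.
by rewrite scalerDr !scalerA -addrA -scalerDl mulrDl mul1r [r * _]mulrC.
Qed.

End JunctureSums.

Section JunctureCoef.
Variables (K : fieldType) (r : K) (n m : nat).
Implicit Types w : seq ('I_n + 'I_m).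

Definition juncture_coef_at w (l : nat) (j : juncture) : K :=
  if j is Bullet then
    match onth w l, onth w l.+1 with Some x, Some y => bullet_coef r x y | _, _ => 0 end
  else 1.

Lemma prod_juncture_coef k w (o : k.-tuple juncture) : size w = k.+1 ->
  \prod_(l < k) juncture_coef_at w l (tnth o l) = juncture_coef r w o.
Proof.
elim: k w o => [|k IHk] [|x [|y w]] o // => [_|[sw]].
  by rewrite big_ord0.
case/tupleP: o => j o; rewrite big_ord_recl tnth0.
have -> : juncture_coef r (x :: y :: w) [tuple of j :: o] =
  (if j is Bullet then bullet_coef r x y else 1) * juncture_coef r (y :: w) o by [].
rewrite -IHk /= ?sw //.
congr (_ * _); apply: eq_bigr => l _.
by rewrite tnthS /juncture_coef_at.
Qed.

(** An inadmissible bullet is a factor 0. Otherwise [n2] and [n3] are sums of indicators, the powers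
    become products over positions, and the factors agree one by one. *)
Lemma admissible_coef (w : word n m) (o : (n + m).-1.-tuple juncture) :
  (0 < n + m)%N ->
  (if admissible w o then (-1) ^+ (n2 w o + n3 w o) * (- (r - 1)) ^+ n2 w o else 0) =
  juncture_coef r w o.
Proof.
move=> nm0; rewrite -prod_juncture_coef; last by rewrite size_tuple prednK.
have [/forallP adm|] := boolP (admissible w o); last first.
  rewrite negb_forall => /existsP[l]; rewrite negb_imply => /andP[/eqP oB wl].
  rewrite (bigD1 l) //= {1}/juncture_coef_at oB; move: wl; rewrite /rho_at /sigma_at.
  by case: (onth w l) (onth w l.+1) => [[i|i]|] [[j|j]|] //= _; rewrite mul0r.
have cardE (P : pred 'I_(n + m).-1) : #|[set l | P l]| = (\sum_l P l)%N.
  by rewrite -sum1dep_card big_mkcond; apply: eq_bigr => l _; case: (P l).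
rewrite /n2 /n3 !cardE exprD -!prodrXr -!big_split /=.
apply: eq_bigr => l _; have := adm l; rewrite /juncture_coef_at /rho_at /sigma_at.
move: (onth w l) (onth w l.+1) => x y; case: (tnth o l) => /=; first by rewrite !expr0 !mulr1.
by case: x y => [[i|i]|] [[j|j]|] //= _;
  rewrite ?expr1 ?expr0 ?mulr1 ?mul1r ?mulN1r ?opprK.
Qed.

End JunctureCoef.

(** * The product as a bilinear extension *)

Section Star.
Variable K : fieldType.
Implicit Types (u v : ParQSym K).

Definition mextend (V : lmodType K) (g : pdiag -> V) u : V :=
  \sum_(p <- msupp u) u@_p *: g p.

Lemma mextendEw (V : lmodType K) (g : pdiag -> V) u (d : {fset pdiag}) :
  (msupp u `<=` d)%fset -> mextend g u = \sum_(p <- d) u@_p *: g p.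
Proof.
move=> le; rewrite /mextend (big_fset_incl _ le) // => p _ /mcoeff_outdom ->.
by rewrite scale0r.
Qed.

Lemma mextendD (V : lmodType K) (g : pdiag -> V) :
  {morph mextend g : u v / u + v}.
Proof.
move=> u v; rewrite (@mextendEw _ g _ _ (msuppD_le u v)).
rewrite (@mextendEw _ g _ _ (fsubsetUl (msupp u) (msupp v))).
rewrite (@mextendEw _ g _ _ (fsubsetUr (msupp u) (msupp v))).
by rewrite -big_split; apply: eq_bigr => p _; rewrite mcoeffD scalerDl.
Qed.

Lemma mextendZU (V : lmodType K) (g : pdiag -> V) a p :
  mextend g (a *: Mbasis K p) = a *: g p.
Proof.
have le : (msupp (a *: Mbasis K p) `<=` [fset p])%fset.
  exact: fsubset_trans (msuppZ_le _ _) msuppU_le.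
rewrite (@mextendEw _ g _ _ le).
by rewrite big_seq_fset1 mcoeffZ mcoeffUU mulr1.
Qed.

Lemma mextend_sum (V : lmodType K) (g : pdiag -> V) T (s : seq T)
    (a : T -> K) (h : T -> pdiag) :
  mextend g (\sum_(t <- s) a t *: Mbasis K (h t)) = \sum_(t <- s) a t *: g (h t).
Proof.
elim: s => [|t s IHs]; first by rewrite !big_nil /mextend msupp0 big_seq_fset0.
by rewrite !big_cons mextendD mextendZU IHs.
Qed.

Lemma star_mextend u v :
  star u v = mextend (fun p => mextend (star_basis K p) v) u.
Proof.
apply: eq_bigr => p _; rewrite scaler_sumr.
by apply: eq_bigr => q _; rewrite scalerA.
Qed.

Lemma star_basis_tensors C D : C != [::] -> D != [::] ->
  (forall c, c \in C -> irr Tensor c) -> (forall d, d \in D -> irr Tensor d) ->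
  star_basis K (tensors C) (tensors D) = stuffle_sum (@Mbasis K) C D.
Proof.
move=> C0 D0 iC iD.
have zN s : (forall c, c \in s -> irr Tensor c) -> pempty \notin s.
  by move=> is_; apply/negP => /is_/irr_neq0; rewrite eqxx.
have ne s : s != [::] -> (forall c, c \in s -> irr Tensor c) -> tensors s != pempty.
  by case: s => // c s _ is_; apply/tensors_cons_neq0/irr_neq0/is_/mem_head.
rewrite /star_basis (negPf (ne _ C0 iC)) (negPf (ne _ D0 iD)).
rewrite !tensor_factors_tensors // stufflesE ?zN //.
by rewrite -fsbig_seq ?stuffle_list_uniq ?zN.
Qed.

(** Bilinearity moves the product inside both coarsening sums, where it meets basis elements with
    known [⊗]-factors. *)
Lemma star_eta (r : K) A B : A != [::] -> B != [::] ->
  (forall a, a \in A -> irr Tensor a) -> (forall b, b \in B -> irr Tensor b) ->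
  star (eta r (tensors A)) (eta r (tensors B)) = eta_prod r (@Mbasis K) A B.
Proof.
move=> A0 B0 iA iB; rewrite star_mextend.
have etaE s : s != [::] -> (forall x, x \in s -> irr Tensor x) ->
    eta r (tensors s) = coarse_sum r s (@Mbasis K \o tensors).
  exact: eta_val_tensors.
rewrite !etaE // mextend_sum; apply: eq_coarse_sum => C CA.
rewrite mextend_sum; apply: eq_coarse_sum => D DB.
apply: star_basis_tensors; rewrite ?(coarsenings_neq0 CA) ?(coarsenings_neq0 DB) //.
  exact: coarsenings_irr CA.
exact: coarsenings_irr DB.
Qed.

End Star.

Theorem proposition9p2 (K : fieldType) (r q : K)
    (r_inv : r \is a GRing.unit) (qE : q = r - 1)
    (n m : nat) (rho : 'I_n -> pdiag) (sigma : 'I_m -> pdiag)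
    (rho_irr : forall i, rho i != pempty /\ irreducible tensor (rho i))
    (sigma_irr : forall j, sigma j != pempty /\ irreducible tensor (sigma j))
    (R S : pdiag) (R_neq0 : R != pempty) (S_neq0 : S != pempty)
    (RE : R = tensors [seq rho i | i <- enum 'I_n])
    (SE : S = tensors [seq sigma j | j <- enum 'I_m]) :
  star (eta r R) (eta r S) =
  \sum_(w : word n m | is_shuffle w)
    \sum_(o : (n + m).-1.-tuple juncture | admissible w o)
      ((-1) ^+ (n2 w o + n3 w o) * (- q) ^+ n2 w o)
        *: eta r (expression (letters rho sigma w) o).
Proof.
pose g (x : 'I_n + 'I_m) := match x with inl i => rho i | inr j => sigma j end.
have g_irr x : irr Tensor (g x) by case: x => [i|j]; [apply: rho_irr|apply: sigma_irr].
have A0 : [seq g (inl i) | i <- enum 'I_n] != [::].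
  by apply: contraNneq R_neq0 => A0; rewrite RE -[map rho _]/(map (g \o inl) _) A0.
have B0 : [seq g (inr j) | j <- enum 'I_m] != [::].
  by apply: contraNneq S_neq0 => B0; rewrite SE -[map sigma _]/(map (g \o inr) _) B0.
rewrite RE SE (star_eta r A0 B0); last 2 first.
- by move=> _ /mapP[i _ ->]; apply: g_irr.
- by move=> _ /mapP[j _ ->]; apply: g_irr.
have [_ _ ->] := eta_prod_shuffle r g_irr (@Mbasis K) (enum 'I_n) (enum 'I_m).
rewrite /shuffle_sum -sum_is_shuffle; apply: eq_bigr => w _.
have nm0 : (0 < n + m)%N.
  by rewrite addn_gt0 lt0n -(size_enum_ord n) -(size_map (g \o inl)) size_eq0 A0.
rewrite (word_sum_tuple _ _ (k := (n + m).-1) g_irr); last by rewrite size_tuple prednK.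
(* [juncture_coef] is 0 at inadmissible junctures, so the restricted sum extends to all of them. *)
rewrite [RHS]big_mkcond /=; apply: eq_bigr => o _; rewrite -admissible_coef // qE.
by case: ifP => // _; rewrite scale0r.
Qed.
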